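(* Let $\mathbb{K}$ be a field of characteristic zero, $\mathcal{K}$ a non-empty set of finite groups, and $\ell : \mathbb{N}-\{0\} \to \mathbb{K}^\times$ a monoid homomorphism. The bijective correspondence $[S]\leftrightarrow[E,W]$, given by $S\cong S_{E,W}$, between the isomorphism classes of simple $\Lambda$-modules and the equivalence classes of $\mathcal{S}$-seeds for $\mathcal{K}$ is characterized as follows. Given a simple $\Lambda$-module $S$ then, up to equivalence, the $\mathcal{S}$-seed $(E,W)$ for $\mathcal{K}$ associated with $S$ is determined by the following three conditions: (a) For any $G\in\mathcal{K}$, we have $S(G)\neq0$ if and only if $[E]\leq[G]$. (b) Given $G\in\mathcal{K}$, subgroups $G\geq B\unrhd Y$, an isomorphism $\phi:B/Y\to E$ and an idempotent $k$ of $\mathbb{K}\,\mathrm{Aut}(E)$, then $\mu_\phi(k)S(G)\neq0$ if and only if $kW\neq0$. (c) The isomorphism class $[E]$ is minimal in the sense that, given an $\mathcal{S}$-seed $(E',W')$ for $\mathcal{K}$ satisfying conditions (a) and (b), then $[E]\leq[E']$.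
   Context: Subgroups of direct products: for groups $F,G$, elements of $F\times G$ are written $f\times g$, and $\mathcal{S}(F,G)$ is the set of subgroups of $F\times G$. For $U\in\mathcal{S}(F,G)$, put $U_\bullet=\{g\in G: 1\times g\in U\}$ and ${}_\bullet U=\{f\in F: f\times 1\in U\}$. For $U\in\mathcal{S}(F,G)$, $V\in\mathcal{S}(G,H)$, the star product $U*V\in\mathcal{S}(F,H)$ is the subgroup of those $f\times h$ for which there exists $g\in G$ with $f\times g\in U$ and $g\times h\in V$. Put $\sigma(U,V)=\ell(|U_\bullet\cap{}_\bullet V|)$. For a finite group $Y$, $\ell(Y)$ means $\ell(|Y|)$. For any set $\mathcal{K}$ of finite groups, the algebra $\Lambda=\Lambda_{\mathcal{K}}$ over $\mathbb{K}$ (not necessarily unital) has $\mathbb{K}$-basis consisting of formal symbols $s_U^{F,G}$ with $F,G\in\mathcal{K}$ and $U\in\mathcal{S}(F,G)$, with multiplication $s_U^{F,G}s_V^{G,H}=\sigma(U,V)\,s_{U*V}^{F,H}$, and $s_U^{F,G}s_V^{G',H}=0$ when $G\neq G'$. For $G\in\mathcal{K}$, $\mathrm{id}_G=s_{\Delta(G)}^{G,G}$ with $\Delta(G)=\{g\times g:g\in G\}$, and $\mathrm{End}_\Lambda(G)=\mathrm{id}_G\,\Lambda\,\mathrm{id}_G$. In a $\Lambda$-module, every element is required to be fixed by some idempotent of $\Lambda$. For a $\Lambda$-module $M$, $M(G)=\mathrm{id}_G M$. A factor group of $R$ is a group isomorphic to a subquotient $M/N$ of $R$ ($R\geq M\unrhd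 N$); write $[S]\leq[R]$ when $S$ is a factor group of $R$. This is a partial order on isomorphism classes of finite groups. For $E\in\mathcal{K}$, $\mu_E:\mathbb{K}\mathrm{Aut}(E)\to\mathrm{End}_\Lambda(E)$ is the unital algebra monomorphism $\theta\mapsto s^{E,E}_{\Delta(\theta)}$, where $\Delta(\theta)=\{\theta(e)\times e: e\in E\}$, and $\mathrm{Res}^{\mu_E}$ is restriction along $\mu_E$. For a finite group $E$, $G\in\mathcal{K}$, $G\geq B\unrhd Y$ and an isomorphism $\phi:B/Y\to E$, $\mu_\phi:\mathbb{K}\mathrm{Aut}(E)\to\mathrm{End}_\Lambda(G)$ is the algebra monomorphism given, for $\epsilon\in\mathrm{Aut}(E)$, by $\mu_\phi(\epsilon)=\ell(Y)^{-1}s_{\Delta(B,Y,\phi^{-1}\epsilon\phi,Y,B)}^{G,G}$, where $\Delta(B,Y,\alpha,Y,B)=\{x\times y\in B\times B: xY=\alpha(yY)\}$ for $\alpha\in\mathrm{Aut}(B/Y)$. An $\mathcal{S}$-seed for $\mathcal{K}$ is a pair $(E,W)$ where $E$ is a factor group of an element of $\mathcal{K}$ and $W$ is a simple $\mathbb{K}\mathrm{Aut}(E)$-module. Seeds $(E,W)$ and $(E',W')$ are equivalent if there is a group isomorphism $\theta:E'\to E$ such that $W$ is isomorphic to the transport of $W'$ along the induced isomorphism $\mathbb{K}\mathrm{Aut}(E')\to\mathbb{K}\mathrm{Aut}(E)$. Definition of $S_{E,W}$: choose a set $\mathcal{K}'\supseteq\mathcal{K}$ of finite groups containing an isomorphic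 copy of every subquotient of every element of $\mathcal{K}'$, and let $\Lambda'=\Lambda_{\mathcal{K}'}\supseteq\Lambda$. Replacing $(E,W)$ by an equivalent seed, suppose $E\in\mathcal{K}'$. There is, up to isomorphism, a unique simple $\Lambda'$-module $S'$ such that $[E]$ is minimal subject to $S'(E)\neq0$ and such that $W\cong\mathrm{Res}^{\mu_E}(S'(E))$. Then $S_{E,W}=\Lambda S'$, a simple $\Lambda$-module, independent up to isomorphism of the choices. The map $[E,W]\mapsto[S_{E,W}]$ is a bijection from equivalence classes of $\mathcal{S}$-seeds for $\mathcal{K}$ to isomorphism classes of simple $\Lambda$-modules; the seed associated with $S$ is the one with $S\cong S_{E,W}$. *)

(* Defs.v *)
From HB Require Import structures.
From mathcomp Require Import all_boot all_order all_algebra all_fingroup.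
From mathcomp Require Import all_solvable mxrepresentation.
From mathcomp Require Import finmap.
From mathcomp.multinomials Require Import monalg.

Set Implicit Arguments.
Unset Strict Implicit.
Unset Printing Implicit Defensive.

Import GRing.Theory.
Local Open Scope ring_scope.

(* [S] <= [R]: S is isomorphic to a subquotient of R. *)
Definition factor_group (S R : finGroupType) : Prop :=
  exists M N : {group R}, (N <| M)%g /\ ([set: S] \isog (M / N)%g).

Section StarProduct.
Variables F G H : finGroupType.
Implicit Types (U : {group F * G}) (V : {group G * H}).

Definition rbullet U : {set G} := [set g | (1%g, g) \in U].
Definition lbullet V : {set G} := [set g | (g, 1%g) \in V].

Definition star_set U V : {set F * H} :=
  [set p | [exists g : G, ((p.1, g) \in U) && ((g, p.2) \in V)]].

Lemma star_group_set U V : group_set (star_set U V).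
Proof.
apply/group_setP; split=> [|[f h] [f' h']].
  by rewrite inE; apply/existsP; exists 1%g; rewrite !group1.
rewrite !inE => /existsP[g /andP[Ug Vg]] /existsP[g' /andP[Ug' Vg']].
apply/existsP; exists (g * g')%g.
by rewrite (groupM Ug Ug') (groupM Vg Vg').
Qed.
Definition star U V : {group F * H} := Group (star_group_set U V).
End StarProduct.

(* Delta(B, Y, alpha, Y, B).  It is a subgroup of G * G when Y <| B and alpha
   is an automorphism of B / Y (see Delta_group_set and mu_aut_group); sectionDelta is the
   subgroup it generates, so that no proof has to be carried around. *)
Section SectionDelta.
Variables (G : finGroupType) (B Y : {group G}) (alpha : coset_of Y -> coset_of Y).

Definition Delta_set : {set G * G} :=
  [set p | [&& p.1 \in B, p.2 \in B & coset Y p.1 == alpha (coset Y p.2)]].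
Definition sectionDelta : {group G * G} := generated_group Delta_set.

Lemma Delta_group_set : (Y <| B)%g ->
  {in (B / Y)%g &, {morph alpha : x y / (x * y)%g}} -> group_set Delta_set.
Proof.
move=> /andP[_ nYB] alphaM.
have in_q b : b \in B -> coset Y b \in (B / Y)%g by move/(mem_quotient Y).
have alpha1 : alpha 1%g = 1%g.
  apply: (mulgI (alpha 1%g)).
  by rewrite mulg1 -[in RHS](mulg1 1%g) alphaM ?group1.
apply/group_setP; split=> [|[x y] [x' y']].
  by rewrite inE /= !group1 !morph1 alpha1 eqxx.
rewrite !inE /= => /and3P[Bx By /eqP e] /and3P[Bx' By' /eqP e'].
have cosetM u v : u \in B -> v \in B ->
    coset Y (u * v)%g = (coset Y u * coset Y v)%g.
  by move=> Bu Bv; rewrite morphM ?(subsetP nYB).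
rewrite !groupM //= (cosetM x x') // (cosetM y y') // alphaM ?in_q //.
by apply/eqP; congr (_ * _)%g.
Qed.
End SectionDelta.

(* Delta(theta) = {theta(e) x e}; a subgroup when theta is an endomorphism. *)
Section GraphDelta.
Variables (E : finGroupType) (theta : E -> E).

Definition graph_set : {set E * E} := [set p | p.1 == theta p.2].
Definition graphDelta : {group E * E} := generated_group graph_set.

Lemma graph_group_set : {morph theta : x y / (x * y)%g} -> group_set graph_set.
Proof.
move=> thetaM; have theta1 : theta 1%g = 1%g.
  by apply: (mulgI (theta 1%g)); rewrite mulg1 -[in RHS](mulg1 1%g) thetaM.
apply/group_setP; split=> [|[x y] [x' y']]; first by rewrite inE /= theta1.
by rewrite !inE /= => /eqP-> /eqP->; rewrite thetaM.
Qed.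
End GraphDelta.

Definition monoid_hom (K : fieldType) (ell : nat -> K) : Prop :=
  [/\ ell 1%N = 1,
      forall m n, (0 < m)%N -> (0 < n)%N -> ell (m * n)%N = ell m * ell n
    & forall n, (0 < n)%N -> ell n != 0].

(* A set of finite groups is given as a family gT indexed by a choiceType.
   Sb i j U stands for s_U^{F,G}, with F = gT i and G = gT j. *)
Record sbasis (I : choiceType) (gT : I -> finGroupType) := Sb {
  sb_l : I;
  sb_r : I;
  sb_grp : {group gT sb_l * gT sb_r} }.
Arguments Sb {I gT i j} U : rename.

Section SbasisChoice.
Variables (I : choiceType) (gT : I -> finGroupType).

Definition sbasis_code (u : sbasis gT) :
    {i : I & {j : I & {group gT i * gT j}}} :=
  Tagged (fun i => {j : I & {group gT i * gT j}})
    (Tagged (fun j => {group gT (sb_l u) * gT j}) (sb_grp u)).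
Definition sbasis_decode (c : {i : I & {j : I & {group gT i * gT j}}}) :
    sbasis gT := Sb (tagged (tagged c)).
Lemma sbasis_codeK : cancel sbasis_code sbasis_decode.
Proof. by case. Qed.
HB.instance Definition _ := Choice.copy (sbasis gT) (can_type sbasis_codeK).
End SbasisChoice.

Notation Lambda K gT := {malg K[sbasis gT]}.

Section Algebra.
Variables (K : fieldType) (I : choiceType) (gT : I -> finGroupType).
Variable ell : nat -> K.

Definition s_ (i j : I) (U : {group gT i * gT j}) : Lambda K gT :=
  mkmalgU (Sb U) 1.

Definition sigma (i j k : I) (U : {group gT i * gT j})
    (V : {group gT j * gT k}) : K :=
  ell #|rbullet U :&: lbullet V|.

Definition s_prod (i j j' k : I) (U : {group gT i * gT j})
    (V : {group gT j' * gT k}) : Lambda K gT :=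
  match j' =P j with
  | ReflectT e =>
      let V' := ecast j {group gT j * gT k} e V in
      sigma U V' *: s_ (star U V')
  | ReflectF _ => 0
  end.

Lemma s_prodE i j k (U : {group gT i * gT j}) (V : {group gT j * gT k}) :
  s_prod U V = sigma U V *: s_ (star U V).
Proof.
rewrite /s_prod; case: (j =P j) => [e | ne]; last by case: ne.
by rewrite (eq_axiomK e).
Qed.

Lemma s_prod0 i j j' k (U : {group gT i * gT j}) (V : {group gT j' * gT k}) :
  j != j' -> s_prod U V = 0.
Proof.
move=> /eqP ne; rewrite /s_prod; case: (j' =P j) => [e | //].
by case: ne; rewrite e.
Qed.

Definition Lmul (a b : Lambda K gT) : Lambda K gT :=
  \sum_(u <- msupp a) \sum_(v <- msupp b) (a@_u * b@_v) *: s_prod (sb_grp u) (sb_grp v).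

Definition id_ (i : I) : Lambda K gT := s_ (graphDelta (@id (gT i))).

(* Lambda is not unital in general. *)
Record Lmodule := LModule {
  lcar :> lmodType K;
  lact : Lambda K gT -> lcar -> lcar;
  lact_linearl : forall m, linear (lact^~ m);
  lact_linearr : forall a, linear (lact a);
  lactM : forall a b m, lact (Lmul a b) m = lact a (lact b m);
  lact_idem : forall m, exists e, Lmul e e = e /\ lact e m = m }.

Definition Lsubmodule (M : Lmodule) (P : M -> Prop) : Prop :=
  [/\ P 0, forall (c : K) x y, P x -> P y -> P (c *: x + y)
    & forall a x, P x -> P (lact a x)].

Definition Lsimple (M : Lmodule) : Prop :=
  (exists x : M, x <> 0) /\
  forall P : M -> Prop, Lsubmodule P ->
    (forall x, P x -> x = 0) \/ (forall x, P x).

Definition Liso (M N : Lmodule) : Prop :=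
  exists f : M -> N,
    [/\ linear f, bijective f & forall a x, f (lact a x) = lact a (f x)].

(* membership in M(G) = id_G M *)
Definition at_group (M : Lmodule) (i : I) (x : M) : Prop :=
  exists m : M, x = lact (id_ i) m.

Definition nonzero_at (M : Lmodule) (i : I) : Prop :=
  exists x : M, at_group i x /\ x <> 0.

(* For eps in Aut(E), mu_phi(eps). *)
Definition mu_aut (E : finGroupType) (i : I) (B Y : {group gT i})
    (phi : {morphism (B / Y)%g >-> E}) (iphi : isom (B / Y)%g [set: E] phi)
    (eps : {perm E}) : Lambda K gT :=
  (ell #|Y|)^-1 *:
    s_ (sectionDelta B (fun c => invm (isom_inj iphi) (eps (phi c)))).

Lemma mu_aut_group (E : finGroupType) (i : I) (B Y : {group gT i})
    (phi : {morphism (B / Y)%g >-> E}) (iphi : isom (B / Y)%g [set: E] phi)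
    (eps : {perm E}) (alpha := fun c => invm (isom_inj iphi) (eps (phi c))) :
  (Y <| B)%g -> eps \in Aut [set: E] ->
  sectionDelta B alpha = Delta_set B alpha :> {set _}.
Proof.
move=> nYB /setIdP[_ /morphicP epsM]; apply/gen_set_id/Delta_group_set => //.
move=> x y Bx By; rewrite /alpha morphM // epsM ?inE //.
by rewrite morphM // (isom_im iphi) inE.
Qed.

(* mu_phi extended linearly to K Aut(E).  Elements of K Aut(E) are matrices in
   the library's group_ring, with gring_proj eps extracting the coefficient of
   eps.  In {perm E}, a * b is "first a, then b", so group_ring is the opposite
   of the group algebra for composition; both have the same idempotents. *)
Definition mu (E : finGroupType) (i : I) (B Y : {group gT i})
    (phi : {morphism (B / Y)%g >-> E}) (iphi : isom (B / Y)%g [set: E] phi)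
    (k : 'M[K]_#|Aut [set: E]|) : Lambda K gT :=
  \sum_(eps in Aut [set: E])
    gring_proj (G := Aut_group [set: E]) eps k 0 0 *: mu_aut iphi eps.

End Algebra.

Section Seeds.
Variable K : fieldType.

(* A pair (E, W) with W a K Aut(E)-module, given as a matrix representation
   (simple K Aut(E)-modules are finite-dimensional): theta in Aut(E) sends the
   row vector w to w *m W theta.  As products in {perm E} are compositions
   in the opposite order, this is a left action of Aut(E) for composition. *)
Record aut_pair := AutPair {
  pgrp : finGroupType;
  pdim : nat;
  prep : mx_representation K (Aut_group [set: pgrp]) pdim }.

Definition is_seed (I : choiceType) (gT : I -> finGroupType) (x : aut_pair) :
    Prop :=
  (exists i : I, factor_group (pgrp x) (gT i)) /\ mx_irreducible (prep x).

Section Transport.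
Variables (E' E : finGroupType) (theta : {morphism [set: E'] >-> E}).
Hypothesis itheta : isom [set: E'] [set: E] theta.

Let thetaK : cancel theta (invm (isom_inj itheta)).
Proof. by move=> x; rewrite invmE ?inE. Qed.
Let thetaKV : cancel (invm (isom_inj itheta)) theta.
Proof. by move=> y; rewrite invmK // (isom_im itheta) inE. Qed.

Lemma conj_aut_inj (eps : {perm E}) :
  injective (fun x => invm (isom_inj itheta) (eps (theta x))).
Proof.
by apply: inj_comp (can_inj thetaKV) _; apply: inj_comp perm_inj (can_inj thetaK).
Qed.

(* theta^-1 eps theta *)
Definition conj_aut (eps : {perm E}) : {perm E'} := perm (@conj_aut_inj eps).

Lemma conj_aut_Aut eps : eps \in Aut [set: E] -> conj_aut eps \in Aut [set: E'].
Proof.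
rewrite !inE => /andP[_ /morphicP epsM]; apply/andP; split.
  by apply/subsetP=> x; rewrite inE.
apply/morphicP=> x y _ _; rewrite !permE morphM ?inE // epsM ?inE //.
by rewrite morphM // (isom_im itheta) inE.
Qed.

Lemma conj_autM (a b : {perm E}) :
  conj_aut (a * b) = (conj_aut a * conj_aut b)%g.
Proof.
by apply/permP=> x; rewrite [RHS]permM /conj_aut !permE /= thetaKV.
Qed.

Variables (n : nat) (W' : mx_representation K (Aut_group [set: E']) n).

Lemma transport_mx_repr :
  mx_repr (Aut_group [set: E]) (fun eps => W' (conj_aut eps)).
Proof.
split=> [|a b Aa Ab].
  have -> : conj_aut 1 = 1%g by apply/permP=> x; rewrite permE !perm1 thetaK.
  exact: repr_mx1.
rewrite -repr_mxM ?conj_aut_Aut //; congr (W' _).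
exact: conj_autM.
Qed.

(* the K Aut(E)-module obtained from W' along eps' |-> theta eps' theta^-1 *)
Definition transport : mx_representation K (Aut_group [set: E]) n :=
  MxRepresentation transport_mx_repr.
End Transport.

Definition seed_equiv (x x' : aut_pair) : Prop :=
  exists (theta : {morphism [set: pgrp x'] >-> pgrp x})
         (itheta : isom [set: pgrp x'] [set: pgrp x] theta),
    mx_rsim (prep x) (transport itheta (prep x')).

End Seeds.

(* A set K' of finite groups containing K is presented as the disjoint union of
   the family gT with a family gT' of additional groups. *)
Definition ext_family (I I' : choiceType) (gT : I -> finGroupType)
    (gT' : I' -> finGroupType) (x : (I + I')%type) : finGroupType :=
  match x with inl i => gT i | inr j => gT' j end.

Definition subquotient_closed (I : choiceType) (gT : I -> finGroupType) : Prop :=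
  forall (i : I) (M N : {group gT i}), (N <| M)%g ->
    exists j : I, [set: gT j] \isog (M / N)%g.

Lemma subquotient_trans (gT : finGroupType) (M N : {group gT})
    (P Q : {group [subg (M / N)%G]}) : (Q <| P)%g ->
  exists M1 N1 : {group gT}, (N1 <| M1)%g /\ ((P / Q) \isog (M1 / N1))%g.
Proof.
move=> nQP; pose f := [morphism of restrm (subsetT P) (@sgval _ (M / N)%G)].
have injf : ('injm f)%g by rewrite injm_restrm ?(isom_inj (isom_sgval _)).
have nBA : ((f @* Q)%G <| (f @* P)%G)%g by rewrite morphim_normal.
exists (coset N @*^-1 (f @* P))%G, (coset N @*^-1 (f @* Q))%G; split.
  by rewrite cosetpre_normal.
apply: (isog_trans (H := ((f @* P)%G / (f @* Q)%G)%G)).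
  by rewrite /= -(morphim_quotm f nQP); apply: sub_isog; rewrite ?injm_quotm.
have nNA : (N <| (coset N @*^-1 (f @* P))%G)%g.
  by rewrite /normal sub_cosetpre subsetIl.
have nBAp : ((coset N @*^-1 (f @* Q))%G <| (coset N @*^-1 (f @* P))%G)%g.
  by rewrite cosetpre_normal.
have := third_isog (sub_cosetpre _) nNA nBAp.
by rewrite /= !cosetpreK isog_sym.
Qed.

(* Such an extension always exists. *)
Lemma subquotient_closure (I : choiceType) (gT : I -> finGroupType) :
  exists (I' : choiceType) (gT' : I' -> finGroupType),
    subquotient_closed (ext_family gT gT').
Proof.
exists {i : I & {group gT i} * {group gT i}}%type.
exists (fun c : {i : I & {group gT i} * {group gT i}}%type =>
  let G := quotient_group ((tagged c).1 : {group gT (tag c)})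
             ((tagged c).2 : {group gT (tag c)}) in
  subg_of G : finGroupType).
case=> [i | [i [M N]]] P Q /= nQP.
  exists (inr (Tagged (fun i => {group gT i} * {group gT i})%type (P, Q))).
  by rewrite /= isog_sym isog_subg.
have [M1 [N1 [_ isoPQ]]] := subquotient_trans nQP.
exists (inr (Tagged (fun i => {group gT i} * {group gT i})%type (M1, N1))).
apply: (isog_trans (H := (M1 / N1)%G)); first by rewrite /= isog_sym isog_subg.
by rewrite isog_sym.
Qed.

Section AssociatedSeed.
Variables (K : fieldType) (I I' : choiceType).
Variables (gT : I -> finGroupType) (gT' : I' -> finGroupType).
Variable ell : nat -> K.
Let gX := ext_family gT gT'.

(* the inclusion of Lambda in Lambda' *)
Definition embed_basis (u : sbasis gT) : sbasis gX :=
  @Sb _ gX (inl (sb_l u)) (inl (sb_r u)) (sb_grp u).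
Definition embed (a : Lambda K gT) : Lambda K gX :=
  \sum_(u <- msupp a) a@_u *: mkmalgU (embed_basis u) 1.

(* Lambda S', as a subset of S' *)
Definition Lspan (S' : Lmodule gX ell) (y : S') : Prop :=
  exists r : seq (Lambda K gT * S'), y = \sum_(p <- r) lact (embed p.1) p.2.

Definition iso_Lspan (S : Lmodule gT ell) (S' : Lmodule gX ell) : Prop :=
  exists f : S -> S',
    [/\ linear f, injective f, forall a x, f (lact a x) = lact (embed a) (f x)
      & forall y, Lspan y <-> exists x, f x = y].

Definition minimal_at (S' : Lmodule gX ell) (j : (I + I')%type) : Prop :=
  nonzero_at S' j /\
  forall j', nonzero_at S' j' -> factor_group (gX j') (gX j) ->
    [set: gX j'] \isog [set: gX j].

(* W is isomorphic to the restriction of S'(E) along mu_E *)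
Definition iso_Res (S' : Lmodule gX ell) (j : (I + I')%type) (n : nat)
    (W : mx_representation K (Aut_group [set: gX j]) n) : Prop :=
  exists f : 'rV[K]_n -> S',
    [/\ linear f, injective f, forall y, at_group j y <-> exists w, f w = y
      & forall theta, theta \in Aut [set: gX j] -> forall w,
          f (w *m W theta) = lact (s_ K (graphDelta theta)) (f w)].

(* S is isomorphic to S_{E,W}, with S_{E,W} computed in the extended family. *)
Definition associated (S : Lmodule gT ell) (x : aut_pair K) : Prop :=
  exists (j : (I + I')%type) (n : nat)
         (W : mx_representation K (Aut_group [set: gX j]) n),
    seed_equiv x (AutPair W) /\
    exists S' : Lmodule gX ell,
      [/\ Lsimple S', minimal_at S' j, iso_Res S' W & iso_Lspan S S'].

End AssociatedSeed.

Section Conditions.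
Variables (K : fieldType) (I : choiceType) (gT : I -> finGroupType).
Variables (ell : nat -> K) (S : Lmodule gT ell).

Definition cond_a (x : aut_pair K) : Prop :=
  forall i : I, nonzero_at S i <-> factor_group (pgrp x) (gT i).

Definition cond_b (x : aut_pair K) : Prop :=
  forall (i : I) (B Y : {group gT i}), (Y <| B)%g ->
  forall (phi : {morphism (B / Y)%g >-> pgrp x})
         (iphi : isom (B / Y)%g [set: pgrp x] phi)
         (k : 'M[K]_#|Aut [set: pgrp x]|),
    (k \in group_ring K (Aut_group [set: pgrp x]))%MS -> k *m k = k ->
    (exists m : S, at_group i m /\ lact (mu ell iphi k) m <> 0) <->
    (exists w : 'rV[K]_(pdim x), w *m gring_op (prep x) k <> 0).

Definition cond_c (x : aut_pair K) : Prop :=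
  forall x' : aut_pair K, is_seed gT x' -> cond_a x' -> cond_b x' ->
    factor_group (pgrp x) (pgrp x').

End Conditions.

(* Main.v *)
Require Import Defs.
From HB Require Import structures.
From mathcomp Require Import all_boot all_order all_algebra all_fingroup.
From mathcomp Require Import all_solvable mxrepresentation.
From mathcomp Require Import finmap boolp functions.
From mathcomp.multinomials Require Import monalg.

Set Implicit Arguments.
Unset Strict Implicit.
Unset Printing Implicit Defensive.

Import GRing.Theory.
Local Open Scope ring_scope.

(** Write s_U for the basis element of a subgroup U of F x G, read as a relation
    between F and G, and U^o for the opposite relation. Everything rests on two
    facts about relations.

    - If U is the graph of a homomorphism from a subgroup B of G onto E, with
      kernel Y, then s_{U^o} s_U = ell(Y) id_E, a nonzero multiple of id_E
      (s_op_mul). So s_U embeds M(E) in M(G) for every module M: a module that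
      lives at E lives at every group having E as a factor group.
    - By Goursat's lemma every s_V factors as s_A s_{B^o} through the common
      subquotient of F and G attached to V (goursat, s_factor).

    Let S' be a simple module over a family of groups closed under
    subquotients, and let E be minimal with S'(E) nonzero. Any two places where
    S' lives are joined by some s_V acting as a nonzero map; factoring it, E is a
    factor group of every G with S'(G) nonzero (simple_support), and the basis
    elements of End(E) other than the graphs of automorphisms act as 0 on S'(E)
    (minimal_end). So S'(E) is a simple K Aut(E)-module W, and it determines S':
    two simple modules sharing E and W are linked by the submodule of their
    product generated by a diagonal copy of W (linked_iso, iso_res_unique).

    Conversely, a simple module over a corner of the algebra extends to a simple
    module of the whole algebra: take the image of the induced module in the
    coinduced one (green_module). Applied to the corner id_E Lambda id_E, modulo the
    ideal killing W, this produces the module of a seed (simple_of_aut_rep);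
    applied to the algebra of the given family, inside the algebra of a larger
    family closed under subquotients, it extends a simple module S to a simple
    module S' (simple_extend). Cutting down S' recovers S (simple_cut). This gives
    the bijection between simple modules and seeds.

    As for the three conditions, (a) is simple_support. If phi : B / Y -> E is an
    isomorphism and U the corresponding relation, then mu_phi(k) is
    s_U k s_{U^o} up to a nonzero scalar, so mu_phi(k) S(G) is a copy of k W, which
    is (b) (mu_factor, mu_nonzero). If another seed with group E' satisfies (a)
    and (b), then (b) for the idempotent 1 shows that some composite through E'
    is nonzero on S, so S' lives at E' and E is a factor group of E', which is
    (c) (associated_conditions). Finally let (E', W') satisfy the three
    conditions. By (c), used in both directions, E' and E are factor groups of
    each other, hence isomorphic; by (b) the same idempotents are nonzero on W
    and W', and in characteristic zero the central idempotent of the component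
    of W annihilates the other simple modules, so W and W' are isomorphic
    (irr_rsim_of_idem, conditions_unique). *)

(** * Subgroups of direct products as relations *)

Section Relations.
Implicit Types F G H J : finGroupType.

Lemma pair_mulg F G (f f' : F) (g g' : G) :
  ((f, g) * (f', g') = (f * f', g * g'))%g.
Proof. by []. Qed.

Lemma starP F G H (U : {group F * G}) (V : {group G * H}) f h :
  reflect (exists g, (f, g) \in U /\ (g, h) \in V) ((f, h) \in star U V).
Proof.
rewrite inE /=; apply: (iffP existsP) => [[g /andP[Ug Vg]]|[g [Ug Vg]]].
  by exists g.
by exists g; rewrite Ug Vg.
Qed.

Lemma group_relP F G (U V : {group F * G}) :
  (forall f g, (f, g) \in U <-> (f, g) \in V) -> U = V.
Proof.
move=> UV; apply/group_inj/setP=> -[f g].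
by apply/idP/idP => /UV.
Qed.

Lemma starA F G H J (U : {group F * G}) (V : {group G * H}) (W : {group H * J}) :
  star (star U V) W = star U (star V W).
Proof.
apply: group_relP => f j; split.
  case/starP=> h [/starP[g [Ug Vg]] Wh]; apply/starP; exists g; split=> //.
  by apply/starP; exists h.
case/starP=> g [Ug /starP[h [Vh Wh]]]; apply/starP; exists h; split=> //.
by apply/starP; exists g.
Qed.

Lemma in_rbullet F G (U : {group F * G}) g : (g \in rbullet U) = ((1%g, g) \in U).
Proof. by rewrite inE. Qed.

Lemma in_lbullet F G (U : {group F * G}) f : (f \in lbullet U) = ((f, 1%g) \in U).
Proof. by rewrite inE. Qed.

Lemma card_rel_snd G H (X : {group G * H}) :
  #|X| = (#|[set h | [exists g, (g, h) \in X]]| * #|lbullet X|)%N.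
Proof.
pose p := restrm (subsetT X) (@snd G H).
have -> : [set h | [exists g, (g, h) \in X]] = (p @* X)%g.
  apply/setP=> h; rewrite inE; apply/existsP/morphimP=> [[g Xg]|[[g h'] Xg _ ->]].
    by exists (g, h).
  by exists g.
have -> : #|lbullet X| = #|('ker_X p)%g|.
  rewrite -(card_imset (lbullet X) (can_inj (fun g => erefl : fst (g, 1%g : H) = g))).
  apply: eq_card => -[g h]; apply/imsetP/setIP => [[g' + [-> ->]]|].
    by rewrite inE => Xg; split=> //; apply/kerP.
  case=> Xg /(kerP _ Xg) /= h1; exists g; last by rewrite -h1.
  by rewrite inE -h1.
by rewrite mulnC card_morphim setIid LagrangeI.
Qed.

Lemma op_rel_group_set F G (U : {group F * G}) :
  group_set [set p : G * F | (p.2, p.1) \in U].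
Proof.
apply/group_setP; split=> [|[x y] [x' y']]; first by rewrite inE group1.
by rewrite !inE /=; apply: groupM.
Qed.
Definition op_rel F G (U : {group F * G}) : {group G * F} :=
  Group (op_rel_group_set U).

Lemma in_op_rel F G (U : {group F * G}) f g : ((g, f) \in op_rel U) = ((f, g) \in U).
Proof. by rewrite inE. Qed.

Lemma card_op_rel F G (U : {group F * G}) : #|op_rel U| = #|U|.
Proof.
have sK : cancel (fun p : F * G => (p.2, p.1)) (fun p => (p.2, p.1)) by case.
rewrite -(card_imset U (can_inj sK)); apply: eq_card => -[g f].
rewrite in_op_rel; apply/idP/imsetP => [Uf|[[f' g'] Uf [-> ->]] //].
by exists (f, g).
Qed.

Lemma card_rel_fst G H (X : {group G * H}) :
  #|X| = (#|[set g | [exists h, (g, h) \in X]]| * #|rbullet X|)%N.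
Proof.
rewrite -card_op_rel card_rel_snd; congr (_ * _)%N; apply: eq_card => x;
  rewrite !inE //; apply: eq_existsb => y; exact: in_op_rel.
Qed.

(** The cocycle identity behind associativity of the twisted star product: both
    sides count the pairs (g, h) with 1 x g in U, g x h in V and h x 1 in W, the
    left-hand side by projecting to h and the right-hand side by projecting
    to g. *)
Lemma card_bulletA F G H J (U : {group F * G}) (V : {group G * H})
    (W : {group H * J}) :
  (#|rbullet U :&: lbullet V| * #|rbullet (star U V) :&: lbullet W| =
   #|rbullet V :&: lbullet W| * #|rbullet U :&: lbullet (star V W)|)%N.
Proof.
pose X := [set p : G * H | [&& (1%g, p.1) \in U, p \in V & (p.2, 1%g) \in W]].
have gX : group_set X.
  apply/group_setP; split=> [|[g h] [g' h']]; first by rewrite inE !group1.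
  rewrite !inE /= => /and3P[Ug Vg Wh] /and3P[Ug' Vg' Wh'].
  have := groupM Ug Ug'; have := groupM Wh Wh'.
  by rewrite !pair_mulg !mulg1 => -> ->; rewrite [_ \in V](groupM Vg Vg').
pose Y := Group gX.
have YE g h : (g, h) \in Y = [&& (1%g, g) \in U, (g, h) \in V & (h, 1%g) \in W].
  by rewrite inE.
transitivity #|Y|.
  rewrite card_rel_snd mulnC; congr (_ * _)%N; apply: eq_card => x.
    rewrite in_setI in_rbullet in_lbullet [RHS]inE.
    apply/andP/existsP=> [[/starP[g [Ug Vg]] Wh]|[g]].
      by exists g; rewrite YE Ug Vg.
    by rewrite YE => /and3P[Ug Vg Wh]; split=> //; apply/starP; exists g.
  by rewrite !inE /= group1 andbT.
rewrite card_rel_fst mulnC; congr (_ * _)%N; apply: eq_card => x.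
  by rewrite !inE /= group1.
rewrite inE; apply/existsP/setIP => [[h]|[]].
  rewrite YE => /and3P[Ug Vg Wh]; split; first by rewrite inE.
  by rewrite in_lbullet; apply/starP; exists h.
rewrite in_rbullet in_lbullet => Ug /starP[h [Vg Wh]].
by exists h; rewrite YE Ug Vg.
Qed.

(** A subgroup A of R x S with this property is the graph of a homomorphism from
    a subgroup of R onto S. Such relations present factor groups without
    naming the subquotient, and star products then replace compositions. *)
Definition onto_graph (R S : finGroupType) (A : {group R * S}) : Prop :=
  (forall s, (1%g, s) \in A -> s = 1%g) /\ (forall s, exists r, (r, s) \in A).

Lemma onto_graph_fun (R S : finGroupType) (A : {group R * S}) r s s' :
  onto_graph A -> (r, s) \in A -> (r, s') \in A -> s = s'.
Proof.
case=> A1 _ As As'; apply: (mulIg s'^-1%g); rewrite mulgV; apply: A1.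
by have := groupM As (groupVr As'); rewrite pair_mulg mulgV.
Qed.

Lemma isog_quotientP (S R : finGroupType) (M N : {group R}) :
  [set: S] \isog (M / N)%g -> exists f : S -> coset_of N,
    [/\ {morph f : x y / (x * y)%g}, injective f
      & forall c, c \in (M / N)%g <-> exists s, f s = c].
Proof.
case/isogP=> f injf im_f; exists f; split=> [x y|x y|c].
- by rewrite morphM ?inE.
- by move/(injmP injf); apply; rewrite inE.
rewrite -im_f; split=> [/morphimP[s _ _ ->]|[s <-]]; first by exists s.
by rewrite mem_morphim ?inE.
Qed.

Lemma section_graph (R S : finGroupType) (M N : {group R}) (f : S -> coset_of N) :
  (N <| M)%g -> {morph f : x y / (x * y)%g} -> injective f ->
  (forall c, c \in (M / N)%g <-> exists s, f s = c) ->
  exists2 A : {group R * S}, onto_graph A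
    & forall r s, ((r, s) \in A) = (r \in M) && (coset N r == f s).
Proof.
move=> nNM fM injf im_f; have [_ nN] := andP nNM.
have f1 : f 1%g = 1%g by apply: (mulgI (f 1%g)); rewrite -fM !mulg1.
have cosetM x y : x \in M -> y \in M -> coset N (x * y) = (coset N x * coset N y)%g.
  by move=> Mx My; rewrite morphM ?(subsetP nN).
have gA : group_set [set p : R * S | (p.1 \in M) && (coset N p.1 == f p.2)].
  apply/group_setP; split=> [|[x y] [x' y']]; first by rewrite inE /= group1 f1 morph1 eqxx.
  rewrite !inE /= => /andP[Mx /eqP e] /andP[Mx' /eqP e'].
  by rewrite groupM // cosetM // e e' fM eqxx.
have inA r s : ((r, s) \in Group gA) = (r \in M) && (coset N r == f s).
  by rewrite inE.
exists (Group gA) => //; split=> s.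
  by rewrite inA morph1 => /andP[_ /eqP e]; apply: injf; rewrite -e f1.
have /morphimP[r _ Mr e] : f s \in (M / N)%g by apply/im_f; exists s.
by exists r; rewrite inA Mr -e eqxx.
Qed.

Lemma factor_groupP (S R : finGroupType) :
  factor_group S R <-> exists A : {group R * S}, onto_graph A.
Proof.
split.
  case=> M [N [nNM /isog_quotientP[f [fM injf im_f]]]].
  by have [A oA _] := section_graph nNM fM injf im_f; exists A.
case=> A [A1 A2].
pose p1 := restrm (subsetT A) (@fst R S).
pose p2 := restrm (subsetT A) (@snd R S).
have inj1 : ('injm p1)%g.
  apply/subsetP=> -[r s] /[dup]/dom_ker Ars /(kerP _ Ars) /= r1.
  rewrite /restrm /= in r1; rewrite r1 in Ars *.
  by rewrite (A1 s Ars) inE.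
exists (p1 @* A)%G, (p1 @* 'ker p2)%G; split.
  by rewrite morphim_normal // ker_normal.
have -> : [set: S] = (p2 @* A)%g.
  apply/setP=> s; rewrite inE; symmetry; apply/morphimP.
  by have [r Ars] := A2 s; exists (r, s).
apply: isog_trans (_ : _ \isog A / 'ker p2)%g _; first by rewrite isog_sym first_isog.
have nKA := ker_normal p2.
by rewrite /= -(morphim_quotm p1 nKA); apply: sub_isog; rewrite ?injm_quotm.
Qed.

(** A counting argument: when R is no larger than S, a homomorphism from a
    subgroup of R onto S is an isomorphism of R with S. *)
Lemma onto_graph_bij (R S : finGroupType) (A : {group R * S}) :
  onto_graph A -> (#|R| <= #|S|)%N -> onto_graph (op_rel A).
Proof.
move=> oA leRS; have [A1 A2] := oA.
have [t tA] : exists t : S -> R, forall s, (t s, s) \in A.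
  by exists (fun s => xchoose (A2 s)) => s; apply: (xchooseP (A2 s)).
have t_inj : injective t.
  by move=> x y e; apply: (onto_graph_fun oA (tA x)); rewrite e.
have [u tK uK] := inj_card_bij t_inj leRS.
have uA r s : (r, s) \in A -> u r = s.
  by rewrite -{1}(uK r); apply: onto_graph_fun oA (tA _).
split=> r; last by exists (u r); rewrite in_op_rel -{1}(uK r).
rewrite in_op_rel => /uA e; have /uA e1 := group1 A.
by apply: (can_inj uK); rewrite e e1.
Qed.

Lemma star_onto_graph (R S T : finGroupType) (A : {group R * S}) (B : {group S * T}) :
  onto_graph A -> onto_graph B -> onto_graph (star A B).
Proof.
move=> [A1 A2] [B1 B2]; split=> t.
  by case/starP=> s [/A1-> /B1].
have [s Bs] := B2 t; have [r Ar] := A2 s.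
by exists r; apply/starP; exists s.
Qed.

Lemma factor_group_trans (S R T : finGroupType) :
  factor_group S R -> factor_group R T -> factor_group S T.
Proof.
move=> /factor_groupP[A gA] /factor_groupP[B gB]; apply/factor_groupP.
by exists (star B A); apply: star_onto_graph.
Qed.

Lemma factor_group_card (S R : finGroupType) :
  factor_group S R -> (#|S| <= #|R|)%N.
Proof.
case=> M [N [_ /card_isog]]; rewrite cardsT => ->.
exact: leq_trans (leq_quotient _ _) (max_card _).
Qed.

Lemma isog_factor_group (S R : finGroupType) :
  [set: S] \isog [set: R] -> factor_group S R.
Proof.
move=> iso; exists [set: R]%G, 1%G; split; first exact: normal1.
exact: isog_trans iso (quotient1_isog _).
Qed.

Lemma factor_group_isog (S R : finGroupType) :
  factor_group S R -> (#|R| <= #|S|)%N -> [set: S] \isog [set: R].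
Proof.
case=> M [N [nNM iso]] leRS; have := card_isog iso; rewrite cardsT => cS.
have MT : M :=: [set: R].
  apply/eqP; rewrite eqEcard subsetT cardsT (leq_trans leRS) // cS.
  exact: leq_quotient.
have N1 : N :=: 1%g.
  apply/eqP; rewrite trivg_card1; have := Lagrange_index (normal_sub nNM) (sub1G _).
  move: leRS; rewrite cS card_quotient ?normal_norm // -cardsT -MT.
  rewrite -(Lagrange (normal_sub nNM)) indexg1 => + _.
  rewrite -[X in (_ <= X)%N]mul1n leq_pmul2r // => ?.
  by rewrite eqn_leq cardG_gt0 andbT.
by rewrite -MT; apply: isog_trans iso _; rewrite N1 isog_sym quotient1_isog.
Qed.

Lemma factor_group_anti (S R : finGroupType) :
  factor_group S R -> factor_group R S -> [set: S] \isog [set: R].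
Proof. by move=> SR /factor_group_card; apply: factor_group_isog. Qed.

Lemma in_graphDelta (E : finGroupType) (theta : E -> E) a b :
  {morph theta : x y / (x * y)%g} -> ((a, b) \in graphDelta theta) = (a == theta b).
Proof.
by move=> thetaM; rewrite /= gen_set_id ?inE //; apply: graph_group_set.
Qed.

Lemma in_graph1 (E : finGroupType) (a b : E) : ((a, b) \in graphDelta id) = (a == b).
Proof. exact: in_graphDelta. Qed.

Lemma AutM (E : finGroupType) (theta : {perm E}) : theta \in Aut [set: E] ->
  {morph theta : x y / (x * y)%g}.
Proof. by case/setIdP=> _ /morphicP tM x y; apply: tM; rewrite inE. Qed.

Lemma in_graphAut (E : finGroupType) (theta : {perm E}) a b : theta \in Aut [set: E] ->
  ((a, b) \in graphDelta theta) = (a == theta b).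
Proof. by move=> At; apply: in_graphDelta; apply: AutM. Qed.

Lemma mem_AutT (E : finGroupType) (theta : {perm E}) : {morph theta : x y / (x * y)%g} ->
  theta \in Aut [set: E].
Proof.
move=> tM; rewrite inE; apply/andP; split; last by apply/morphicP=> x y _ _.
by apply/subsetP=> x; rewrite inE.
Qed.

(** As E is finite, a homomorphism from a subgroup of E onto E is defined
    everywhere and bijective. *)
Lemma onto_graph_aut (E : finGroupType) (A : {group E * E}) : onto_graph A ->
  exists2 theta, theta \in Aut [set: E] & A = graphDelta theta.
Proof.
move=> gA; have [A1 A2] := gA.
have [t tA] : exists t : E -> E, forall s, (t s, s) \in A.
  by exists (fun s => xchoose (A2 s)) => s; apply: (xchooseP (A2 s)).
have t_inj : injective t.
  by move=> x y e; apply: (onto_graph_fun gA (tA x)); rewrite e.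
have tE a b : (a, b) \in A -> a = t b.
  have [u tK uK] := injF_bij t_inj.
  by rewrite -{1}(uK a) => Aab; rewrite -(onto_graph_fun gA (tA _) Aab) uK.
have tM : {morph t : x y / (x * y)%g}.
  by move=> x y; symmetry; apply: tE; have := groupM (tA x) (tA y).
have thetaM : {morph perm t_inj : x y / (x * y)%g} by move=> x y; rewrite !permE.
exists (perm t_inj); first exact: mem_AutT.
apply: group_relP => a b; rewrite in_graphAut ?mem_AutT // permE.
by split=> [/tE ->|/eqP->].
Qed.

(** Goursat's lemma. The image M of U in G and the normal subgroup N of all g
    with 1 x g in U have a quotient M / N that is also a quotient of the image of
    U in F. The factorization has trivial twist, as A meets 1 x Q trivially. *)
Lemma goursat F G (U : {group F * G}) :
  exists M N : {group G}, (N <| M)%g /\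
  forall Q : finGroupType, [set: Q] \isog (M / N)%g ->
  exists (A : {group F * Q}) (B : {group G * Q}),
    [/\ onto_graph A, onto_graph B & U = star A (op_rel B)].
Proof.
pose p2 := restrm (subsetT U) (@snd F G).
pose p1 := restrm (subsetT U) (@fst F G).
have inM g : reflect (exists f, (f, g) \in U) (g \in p2 @* U)%g.
  apply: (iffP morphimP) => [[[f g'] Ufg _ ->]|[f Uf]]; first by exists f.
  by exists (f, g).
have inN g : (g \in p2 @* 'ker p1)%g = ((1%g, g) \in U).
  apply/morphimP/idP => [[[f g'] U' /(kerP _ U') /= f1 ->]|Ug].
    by rewrite -f1.
  by exists (1%g, g) => //; apply/kerP.
exists (p2 @* U)%G, (p2 @* 'ker p1)%G.
have nNM : (p2 @* 'ker p1 <| p2 @* U)%g by rewrite morphim_normal // ker_normal.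
split=> // Q /isog_quotientP[psi [psiM injpsi im_psi]].
have psi1 : psi 1%g = 1%g by apply: (mulgI (psi 1%g)); rewrite -psiM !mulg1.
have [_ nN] := andP nNM.
set N := (p2 @* 'ker p1)%G; set M := (p2 @* U)%G.
have [B oB inB] := section_graph nNM psiM injpsi im_psi.
exists (star U B), B; split=> //.
  split=> s.
    case/starP=> g [Ug]; rewrite inB => /andP[_ /eqP e]; rewrite -inN in Ug.
    by apply: injpsi; rewrite psi1 -e coset_id.
  have [g Bg] := oB.2 s; have := Bg; rewrite inB => /andP[/inM[f Uf] _].
  by exists f; apply/starP; exists g.
apply: group_relP => f g; split=> [Uf|/starP[q [/starP[g' [Uf Bg']]]]].
  have Mg : g \in M by apply/inM; exists f.
  have /im_psi[q e] : coset N g \in (M / N)%g by apply: mem_quotient.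
  apply/starP; exists q; split; last by rewrite in_op_rel inB Mg e eqxx.
  by apply/starP; exists g; rewrite inB Mg e eqxx.
rewrite in_op_rel => Bg; move: Bg' Bg; rewrite !inB.
case/andP=> Mg' /eqP e' /andP[Mg /eqP e].
have : (g'^-1 * g)%g \in N.
  have [nNg nNg'] := (subsetP nN g Mg, subsetP nN g' Mg').
  apply: coset_idr; rewrite ?groupM ?groupV // morphM ?morphV ?groupV //.
  by have := mulVg (psi q); rewrite -{1}e' -e.
rewrite inN => Ng; have := groupM Uf Ng.
by rewrite pair_mulg mulg1 mulKVg.
Qed.

End Relations.
(** * The twisted algebra *)

Section LinearFacts.
Variables (K : fieldType) (V W : lmodType K) (f : V -> W).
Hypothesis linf : linear f.

Lemma lin0 : f 0 = 0.
Proof. by have := linf (-1) 0 0; rewrite scaler0 add0r scaleN1r addNr. Qed.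
Lemma linD x y : f (x + y) = f x + f y.
Proof. by have := linf 1 x y; rewrite !scale1r. Qed.
Lemma linZ c x : f (c *: x) = c *: f x.
Proof. by have := linf c x 0; rewrite lin0 !addr0. Qed.
Lemma lin_sum J r (P : pred J) (F : J -> V) :
  f (\sum_(i <- r | P i) F i) = \sum_(i <- r | P i) f (F i).
Proof. by apply: (big_morph f linD lin0). Qed.

Lemma lin_scale_eq (g : V -> W) c x : linear g -> f x = g x -> f (c *: x) = g (c *: x).
Proof.
move=> ling; rewrite linZ => ->.
by have := ling c x 0; rewrite !addr0; have := ling (-1) 0 0;
  rewrite scaler0 add0r scaleN1r addNr => ->; rewrite addr0.
Qed.

End LinearFacts.

Lemma lin_comp (K : fieldType) (U V W : lmodType K) (f : V -> W) (g : U -> V) :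
  linear f -> linear g -> linear (fun x => f (g x)).
Proof. by move=> linf ling c x y; rewrite ling linf. Qed.

Section LinearExtension.
Variables (K : fieldType) (B : choiceType) (V : lmodType K).
Implicit Types (a b : {malg K[B]}).

Definition lext (phi : B -> V) (a : {malg K[B]}) : V :=
  \sum_(u <- msupp a) a@_u *: phi u.

Lemma lext_fset phi a (d : {fset B}) : (msupp a `<=` d)%fset ->
  lext phi a = \sum_(u <- d) a@_u *: phi u.
Proof.
move=> ad; rewrite /lext (big_fset_incl _ ad) // => u _ /mcoeff_outdom->.
by rewrite scale0r.
Qed.

Lemma lext_linear phi : linear (lext phi).
Proof.
move=> c a b.
have sub x : (x \in [:: c *: a + b; a; b])%SEQ ->
    (msupp x `<=` msupp (c *: a + b) `|` msupp a `|` msupp b)%fset.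
  by rewrite !inE => /or3P[] /eqP->; apply/fsubsetP=> u; rewrite !in_fsetE => ->;
    rewrite ?orbT.
rewrite !(lext_fset _ (sub _ _)) ?inE ?eqxx ?orbT // scaler_sumr -big_split /=.
by apply: eq_bigr => u _; rewrite mcoeffD mcoeffZ scalerDl scalerA.
Qed.
HB.instance Definition _ phi :=
  GRing.isLinear.Build K {malg K[B]} V *:%R (lext phi) (lext_linear phi).

Lemma lextU phi u : lext phi (mkmalgU u 1) = phi u.
Proof. by rewrite /lext msuppU oner_eq0 big_seq_fset1 mcoeffUU scale1r. Qed.

Lemma malg_ind (P : {malg K[B]} -> Prop) :
  P 0 -> (forall c u a, P a -> P (c *: mkmalgU u 1 + a)) -> forall a, P a.
Proof.
move=> P0 PS a; rewrite [a]monalgE; elim: (msupp a : seq B) => [|u s IH].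
  by rewrite big_nil.
rewrite big_cons; have -> : mkmalgU u a@_u = a@_u *: mkmalgU u 1 :> {malg K[B]}.
  by apply/malgP=> v; rewrite mcoeffZ !mcoeffU mulr_natr.
exact: PS.
Qed.

Lemma malg_eq_linear (f g : {malg K[B]} -> V) : linear f -> linear g ->
  (forall u, f (mkmalgU u 1) = g (mkmalgU u 1)) -> f =1 g.
Proof.
move=> linf ling fg; elim/malg_ind => [|c u a IH].
  by rewrite (lin0 linf) (lin0 ling).
by rewrite linf ling fg IH.
Qed.

End LinearExtension.

(** The basis elements and the product are sealed, because comparing two
    finitely supported functions by unfolding them is intractable. *)
HB.lock Definition sb (K : fieldType) (I : choiceType) (gT : I -> finGroupType)
  (u : sbasis gT) : Lambda K gT := mkmalgU u 1.
HB.lock Definition lmul (K : fieldType) (I : choiceType) (gT : I -> finGroupType)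
  (ell : nat -> K) (a b : Lambda K gT) : Lambda K gT := Lmul ell a b.
Canonical sb_unlockable := Unlockable sb.unlock.
Canonical lmul_unlockable := Unlockable lmul.unlock.

Section Algebra.
Variables (K : fieldType) (I : choiceType) (gT : I -> finGroupType).
Variable ell : nat -> K.
Hypothesis ell_hom : monoid_hom ell.
Local Notation L := (Lambda K gT).
Local Notation sb := (@sb K I gT).
Local Notation s U := (sb (Sb U)).
Local Notation "a ** b" := (lmul ell a b) (at level 40, left associativity).
Implicit Types (a b c : L) (u v w : sbasis gT).

Lemma s_E i j (U : {group gT i * gT j}) : s_ K U = s U.
Proof. by rewrite unlock. Qed.

Lemma sb_ind (P : L -> Prop) :
  P 0 -> (forall (c : K) u a, P a -> P (c *: sb u + a)) -> forall a, P a.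
Proof. by rewrite unlock; apply: malg_ind. Qed.

Lemma mcoeff_sb u v : (sb u)@_v = (u == v)%:R.
Proof. by rewrite unlock mcoeffU. Qed.

Lemma lext_sb (V : lmodType K) (phi : sbasis gT -> V) u : lext phi (sb u) = phi u.
Proof. by rewrite unlock lextU. Qed.

Lemma sb_eq_linear (V : lmodType K) (f g : L -> V) : linear f -> linear g ->
  (forall u, f (sb u) = g (sb u)) -> f =1 g.
Proof. by rewrite unlock; apply: malg_eq_linear. Qed.

Definition sprod u v : L := s_prod ell (sb_grp u) (sb_grp v).

Lemma LmulE a b : a ** b = lext (fun u => lext (sprod u) b) a.
Proof.
rewrite unlock /Lmul /lext; apply: eq_bigr => u _; rewrite scaler_sumr.
by apply: eq_bigr => v _; rewrite scalerA.
Qed.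

Lemma Lmul_linearl b : linear (fun a => a ** b).
Proof. by move=> c a a'; rewrite !LmulE linearP. Qed.

Lemma Lmul_linearr a : linear (fun b => a ** b).
Proof.
move=> c b b'; rewrite !LmulE /lext scaler_sumr -big_split /=.
apply: eq_bigr => u _; have := lext_linear (sprod u) c b b'; rewrite /lext => ->.
by rewrite scalerDr !scalerA mulrC.
Qed.

Lemma Lmul0l b : 0 ** b = 0. Proof. exact: lin0 (Lmul_linearl b). Qed.
Lemma Lmul0r a : a ** 0 = 0. Proof. exact: lin0 (Lmul_linearr a). Qed.
Lemma LmulZl (x : K) a b : (x *: a) ** b = x *: (a ** b).
Proof. exact: linZ (Lmul_linearl b) _ _. Qed.
Lemma LmulZr (x : K) a b : a ** (x *: b) = x *: (a ** b).
Proof. exact: linZ (Lmul_linearr a) _ _. Qed.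
Lemma LmulDl a a' b : (a + a') ** b = a ** b + a' ** b.
Proof. exact: linD (Lmul_linearl b) _ _. Qed.
Lemma LmulDr a b b' : a ** (b + b') = a ** b + a ** b'.
Proof. exact: linD (Lmul_linearr a) _ _. Qed.
Lemma Lmul_suml J r (P : pred J) (F : J -> L) b :
  (\sum_(i <- r | P i) F i) ** b = \sum_(i <- r | P i) F i ** b.
Proof. exact: (lin_sum (Lmul_linearl b)). Qed.
Lemma Lmul_sumr J r (P : pred J) (F : J -> L) a :
  a ** (\sum_(i <- r | P i) F i) = \sum_(i <- r | P i) a ** F i.
Proof. exact: (lin_sum (Lmul_linearr a)). Qed.

Lemma Lmul_sb u v : sb u ** sb v = sprod u v.
Proof. by rewrite LmulE !lext_sb. Qed.

Lemma Lmul_s i j k (U : {group gT i * gT j}) (V : {group gT j * gT k}) :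
  s U ** s V = sigma ell U V *: s (star U V).
Proof. by rewrite -[in RHS]s_E -s_prodE; apply: Lmul_sb. Qed.

Lemma Lmul_sb0 u v : sb_r u != sb_l v -> sb u ** sb v = 0.
Proof. by move=> ne; rewrite Lmul_sb; apply: s_prod0. Qed.

Lemma ell1 : ell 1 = 1. Proof. by case: ell_hom. Qed.

Lemma ell_neq0 n : (0 < n)%N -> ell n != 0.
Proof. by case: ell_hom => _ _; apply. Qed.

Lemma card_bullet_gt0 (F G H : finGroupType) (U : {group F * G}) (V : {group G * H}) :
  (0 < #|rbullet U :&: lbullet V|)%N.
Proof. by apply/card_gt0P; exists 1%g; rewrite !inE !group1. Qed.

(** The twists agree by card_bulletA, as ell is multiplicative. *)
Lemma LmulA_sb u v w : sb u ** sb v ** sb w = sb u ** (sb v ** sb w).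
Proof.
have [uv|] := eqVneq (sb_r u) (sb_l v); last first.
  move=> uv; rewrite (Lmul_sb0 uv) Lmul0l.
  have [vw|vw] := eqVneq (sb_r v) (sb_l w); last by rewrite (Lmul_sb0 vw) Lmul0r.
  case: u v w uv vw => i j U [j' k V] [k' l W] /= uv e; subst k'.
  by rewrite Lmul_s LmulZr Lmul_sb0 ?scaler0.
have [vw|vw] := eqVneq (sb_r v) (sb_l w); last first.
  rewrite (Lmul_sb0 vw) Lmul0r.
  case: u v w uv vw => i j U [j' k V] [k' l W] /= e vw; subst j'.
  by rewrite Lmul_s LmulZl Lmul_sb0 ?scaler0.
case: u v w uv vw => i j U [j' k V] [k' l W] /= e e'; subst j' k'.
rewrite !Lmul_s LmulZl LmulZr !Lmul_s !scalerA starA.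
suff -> : sigma ell U V * sigma ell (star U V) W =
          sigma ell V W * sigma ell U (star V W) by [].
case: ell_hom => _ ellM _; rewrite /sigma -!ellM ?card_bullet_gt0 //.
by rewrite card_bulletA.
Qed.

Lemma LmulA a b c : a ** (b ** c) = a ** b ** c.
Proof.
have A1 u v : sb u ** (sb v ** c) = sb u ** sb v ** c.
  elim/sb_ind: c => [|z w c IH]; first by rewrite !Lmul0r.
  by rewrite !LmulDr !LmulZr IH LmulA_sb.
have A2 u : sb u ** (b ** c) = sb u ** b ** c.
  elim/sb_ind: b => [|z v b IH]; first by rewrite Lmul0l Lmul0r Lmul0l.
  by rewrite LmulDl LmulZl !LmulDr !LmulZr LmulDl LmulZl IH A1.
elim/sb_ind: a => [|z u a IH]; first by rewrite !Lmul0l.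
by rewrite !LmulDl !LmulZl IH A2.
Qed.

Lemma sigma1 i j k (U : {group gT i * gT j}) (V : {group gT j * gT k}) :
  (forall g, (1%g, g) \in U -> (g, 1%g) \in V -> g = 1%g) -> sigma ell U V = 1.
Proof.
move=> UV; rewrite /sigma (_ : _ :&: _ = [set 1%g]) ?cards1 ?ell1 //.
apply/setP=> g; rewrite in_setI in_rbullet in_lbullet inE.
by apply/andP/eqP=> [[]|->]; [apply: UV | rewrite !group1].
Qed.

Lemma s_star i j k (U : {group gT i * gT j}) (V : {group gT j * gT k}) :
  (forall g, (1%g, g) \in U -> (g, 1%g) \in V -> g = 1%g) ->
  s U ** s V = s (star U V).
Proof. by move=> UV; rewrite Lmul_s sigma1 // scale1r. Qed.

Definition one_ i : L := s (graphDelta (@id (gT i))).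

Lemma id_E i : id_ K gT i = one_ i. Proof. exact: s_E. Qed.

Lemma one_mul_sb i u : one_ i ** sb u = if sb_l u == i then sb u else 0.
Proof.
case: eqP => [<-|/eqP ne]; last by rewrite Lmul_sb0 // eq_sym.
case: u => j k U /=; rewrite s_star => [|g]; last by rewrite in_graph1 => /eqP.
suff -> : star (graphDelta id) U = U by [].
apply: group_relP => f g; split => [/starP[h []]|Ufg].
  by rewrite in_graph1 => /eqP->.
by apply/starP; exists f; rewrite in_graph1.
Qed.

Lemma sb_mul_one i u : sb u ** one_ i = if sb_r u == i then sb u else 0.
Proof.
case: eqP => [<-|/eqP ne]; last by rewrite Lmul_sb0.
case: u => j k U /=; rewrite s_star => [|g _]; last by rewrite in_graph1 => /eqP.
suff -> : star U (graphDelta id) = U by [].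
apply: group_relP => f g; split => [/starP[h []]|Ufg].
  by move=> + /[!in_graph1] => + /eqP<-.
by apply/starP; exists g; rewrite in_graph1.
Qed.

Lemma one_s i j (U : {group gT i * gT j}) : one_ i ** s U = s U.
Proof. by rewrite one_mul_sb /= eqxx. Qed.

Lemma malg_sumE a : a = \sum_(u <- msupp a) a@_u *: sb u.
Proof.
rewrite [LHS]monalgE; apply: eq_bigr => u _.
by apply/malgP=> v; rewrite mcoeffZ mcoeff_sb mcoeffU mulr_natr.
Qed.

(** Finite sums of the identities id_i are local units: the algebra has no unit
    when the family of groups is infinite. *)
Lemma local_unit (r : seq L) : exists e : L, e ** e = e /\
  forall a, a \in r -> e ** a = a.
Proof.
pose ix := undup (flatten [seq [seq sb_l u | u <- msupp a] | a <- r]).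
pose e := \sum_(i <- ix) one_ i.
have e_sb u : sb_l u \in ix -> e ** sb u = sb u.
  move=> ui; rewrite Lmul_suml (bigD1_seq (sb_l u)) ?undup_uniq //=.
  rewrite one_mul_sb eqxx big1 => [|i /negPf ne]; first exact: addr0.
  by rewrite one_mul_sb eq_sym ne.
exists e; split.
  rewrite {2}/e Lmul_sumr {2}/e; apply: eq_big_seq => i ix_i.
  exact: (e_sb (Sb (graphDelta (@id (gT i))))).
move=> a ra; rewrite [a in RHS]malg_sumE [a in LHS]malg_sumE Lmul_sumr.
apply: eq_big_seq => u ua; rewrite LmulZr e_sb // mem_undup; apply/flattenP.
by exists [seq sb_l u | u <- msupp a]; apply: map_f.
Qed.

(** ** Factoring basis elements *)

Lemma star_opE i j (A : {group gT i * gT j}) : onto_graph A ->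
  star (op_rel A) A = graphDelta id.
Proof.
move=> oA; apply: group_relP => x y; rewrite in_graph1; split.
  by case/starP=> r [/[!in_op_rel] Ax Ay]; apply/eqP/(onto_graph_fun oA Ax Ay).
move=> /eqP<-; have [r Ar] := oA.2 x.
by apply/starP; exists r; rewrite in_op_rel.
Qed.

(** So s_A is injective on the value of a module at the target: a module living
    at a group lives at every group having it as a factor group. *)
Lemma s_op_mul i j (A : {group gT i * gT j}) : onto_graph A ->
  s (op_rel A) ** s A = ell #|lbullet A| *: one_ j.
Proof.
move=> oA; rewrite Lmul_s (star_opE oA) /sigma.
suff -> : #|rbullet (op_rel A) :&: lbullet A| = #|lbullet A| by [].
by apply: eq_card => g; rewrite in_setI in_rbullet in_op_rel in_lbullet andbb.
Qed.

Lemma lbullet_gt0 i j (A : {group gT i * gT j}) : (0 < #|lbullet A|)%N.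
Proof. by apply/card_gt0P; exists 1%g; rewrite in_lbullet group1. Qed.

Lemma s_star_onto i j k (A : {group gT i * gT j}) (V : {group gT j * gT k}) :
  onto_graph A -> s A ** s V = s (star A V).
Proof. by move=> oA; rewrite s_star // => g /oA.1. Qed.

Lemma s_star_op i j k (U : {group gT i * gT j}) (B : {group gT k * gT j}) :
  onto_graph B -> s U ** s (op_rel B) = s (star U (op_rel B)).
Proof. by move=> oB; rewrite s_star // => g _; rewrite in_op_rel => /oB.1. Qed.

End Algebra.
(** * Modules over the twisted algebra *)

Section Modules.
Variables (K : fieldType) (I : choiceType) (gT : I -> finGroupType).
Variable ell : nat -> K.
Hypothesis ell_hom : monoid_hom ell.
Local Notation L := (Lambda K gT).
Local Notation sb := (@sb K I gT).
Local Notation s U := (sb (Sb U)).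
Local Notation "a ** b" := (lmul ell a b) (at level 40, left associativity).
Implicit Types (M N : Lmodule gT ell) (a b e : L).

Section Basics.
Variable M : Lmodule gT ell.
Implicit Types x y : M.

Lemma lact0l x : lact 0 x = 0.
Proof. exact: lin0 (lact_linearl x). Qed.
Lemma lact0r a : lact a (0 : M) = 0.
Proof. exact: lin0 (lact_linearr _). Qed.
Lemma lactDl a b x : lact (a + b) x = lact a x + lact b x.
Proof. exact: linD (lact_linearl x) _ _. Qed.
Lemma lactDr a x y : lact a (x + y) = lact a x + lact a y.
Proof. exact: linD (lact_linearr _) _ _. Qed.
Lemma lactZl (c : K) a x : lact (c *: a) x = c *: lact a x.
Proof. exact: linZ (lact_linearl x) _ _. Qed.
Lemma lactZr (c : K) a x : lact a (c *: x) = c *: lact a x.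
Proof. exact: linZ (lact_linearr _) _ _. Qed.
Lemma lact_suml J r (P : pred J) (F : J -> L) x :
  lact (\sum_(i <- r | P i) F i) x = \sum_(i <- r | P i) lact (F i) x.
Proof. exact: (lin_sum (lact_linearl x)). Qed.
Lemma lact_sumr J r (P : pred J) (F : J -> M) a :
  lact a (\sum_(i <- r | P i) F i) = \sum_(i <- r | P i) lact a (F i).
Proof. exact: (lin_sum (lact_linearr _)). Qed.

Lemma lact_mul a b x : lact (a ** b) x = lact a (lact b x).
Proof. by rewrite unlock lactM. Qed.

Lemma one_one i : one_ K gT i ** one_ K gT i = one_ K gT i.
Proof. exact: one_s. Qed.

Lemma at_groupP i x : at_group i x <-> lact (one_ K gT i) x = x.
Proof.
split=> [[m ->]|e]; last by exists x; rewrite id_E e.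
by rewrite id_E -lact_mul one_one.
Qed.

Lemma at_group_s i j (U : {group gT i * gT j}) x : at_group i (lact (s U) x).
Proof. by apply/at_groupP; rewrite -lact_mul one_s. Qed.

Lemma nonzero_at_s i j (U : {group gT i * gT j}) x :
  lact (s U) x <> 0 -> nonzero_at M i.
Proof. by move=> nz; exists (lact (s U) x); split=> //; apply: at_group_s. Qed.

Lemma act_sb_at j u x : at_group j x -> sb_r u != j -> lact (sb u) x = 0.
Proof.
move=> /at_groupP <- ne; rewrite -lact_mul sb_mul_one //.
by rewrite (negPf ne) lact0l.
Qed.

Lemma one_act_sb j u x : sb_l u != j -> lact (one_ K gT j) (lact (sb u) x) = 0.
Proof. by move=> ne; rewrite -lact_mul one_mul_sb // (negPf ne) lact0l. Qed.

Lemma s_op_lact i j (A : {group gT i * gT j}) x : onto_graph A -> at_group j x ->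
  lact (s (op_rel A)) (lact (s A) x) = ell #|lbullet A| *: x.
Proof. by move=> oA /at_groupP xj; rewrite -lact_mul s_op_mul // lactZl xj. Qed.

Lemma s_lact_inj i j (A : {group gT i * gT j}) x : onto_graph A -> at_group j x ->
  lact (s A) x = 0 -> x = 0.
Proof.
move=> oA xj Ax0; have := s_op_lact oA xj; rewrite Ax0 lact0r => /esym/eqP.
by rewrite scaler_eq0 (negPf (ell_neq0 ell_hom (lbullet_gt0 A))) => /eqP.
Qed.

(** The submodule generated by x contains x, by local units. *)
Lemma simple_generated x : Lsimple M -> x <> 0 -> forall y, exists a, y = lact a x.
Proof.
case=> _ simM nzx; case: (simM (fun y => exists a, y = lact a x)) => //.
  split=> [|c _ _ [a ->] [b ->]|a _ [b ->]].
  - by exists 0; rewrite lact0l.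
  - by exists (c *: a + b); rewrite lactDl lactZl.
  - by exists (a ** b); rewrite lact_mul.
by move=> all0; case: nzx; apply: all0; have [e [_ ex]] := lact_idem x; exists e.
Qed.

Lemma simple_link i j x y : Lsimple M -> at_group j x -> x <> 0 ->
  at_group i y -> y <> 0 -> exists U : {group gT i * gT j}, lact (s U) x <> 0.
Proof.
move=> simM xj nzx /at_groupP yi nzy.
have [a ya] := simple_generated simM nzx y.
apply: contrapT => noU; case: nzy; rewrite -yi ya.
elim/sb_ind: a {ya} => [|c u a IH]; first by rewrite lact0l lact0r.
rewrite lactDl lactDr IH lactZl lactZr addr0.
have [ul|ul] := eqVneq (sb_l u) i; last by rewrite one_act_sb // scaler0.
have [ur|ur] := eqVneq (sb_r u) j; last by rewrite (act_sb_at xj ur) lact0r scaler0.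
case: u ul ur => i' j' U /= ? ?; subst i' j'.
suff -> : lact (s U) x = 0 by rewrite lact0r scaler0.
by apply: contrapT => nz; apply: noU; exists U.
Qed.

End Basics.

(** ** Groups minimal for a module *)

Definition minimal_for M j := nonzero_at M j /\
  forall j', nonzero_at M j' -> factor_group (gT j') (gT j) ->
    [set: gT j'] \isog [set: gT j].

Lemma nonzero_at_factor M i j :
  nonzero_at M j -> factor_group (gT j) (gT i) -> nonzero_at M i.
Proof.
move=> [x [xj nzx]] /factor_groupP[A oA]; apply: (@nonzero_at_s _ _ _ A x).
by move=> /(s_lact_inj oA xj).
Qed.

Lemma minimal_isog M i j : [set: gT i] \isog [set: gT j] ->
  minimal_for M j -> minimal_for M i.
Proof.
move=> ij [nzj minj]; split.
  by apply: nonzero_at_factor nzj _; apply: isog_factor_group; rewrite isog_sym.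
move=> k nzk ki; apply: (isog_trans (minj _ nzk _)); last by rewrite isog_sym.
exact: factor_group_trans ki (isog_factor_group ij).
Qed.

Hypothesis closed : subquotient_closed gT.

Lemma s_factor i j (U : {group gT i * gT j}) :
  exists q (A : {group gT i * gT q}) (B : {group gT j * gT q}),
    [/\ onto_graph A, onto_graph B, U = star A (op_rel B)
      & s U = s A ** s (op_rel B)].
Proof.
have [M [N [nNM gou]]] := goursat U.
have [q iso] := closed nNM.
have [A [B [oA oB e]]] := gou _ iso.
by exists q, A, B; split=> //; rewrite s_star_op // -e.
Qed.

(** The map s_U factors through a common factor group of both sides where the
    module lives; by minimality this is the minimal group itself. *)
Lemma minimal_factor M i j (U : {group gT i * gT j}) (x : M) :
  minimal_for M j -> lact (s U) x <> 0 -> factor_group (gT j) (gT i).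
Proof.
move=> [_ minj]; have [q [A [B [oA oB _ ->]]]] := s_factor U.
rewrite lact_mul => nz.
have nzq : nonzero_at M q.
  apply: (@nonzero_at_s _ _ _ (op_rel B) x) => z; case: nz.
  by rewrite z lact0r.
have qj : factor_group (gT q) (gT j) by apply/factor_groupP; exists B.
have iso := minj q nzq qj.
apply: (@factor_group_trans _ (gT q)).
  by apply: isog_factor_group; rewrite isog_sym.
by apply/factor_groupP; exists A.
Qed.

(** All places where a simple module lives are linked by nonzero maps, to which
    minimal_factor applies. *)
Lemma simple_support M i j : Lsimple M -> minimal_for M j ->
  nonzero_at M i <-> factor_group (gT j) (gT i).
Proof.
move=> simM minj; split=> [[y [yi nzy]]|]; last exact: nonzero_at_factor minj.1.
have [x [xj nzx]] := minj.1.
have [U nzU] := simple_link simM xj nzx yi nzy.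
exact: minimal_factor minj nzU.
Qed.

(** In a factorization of U through q, minimality of j forces the order of q to
    be that of j, so both factors are graphs of isomorphisms. *)
Lemma minimal_aut M j (U : {group gT j * gT j}) (x : M) :
  minimal_for M j -> lact (s U) x <> 0 ->
  exists2 theta, theta \in Aut [set: gT j] & U = graphDelta theta.
Proof.
move=> [_ minj]; have [q [A [B [oA oB UE ->]]]] := s_factor U.
rewrite lact_mul => nz.
have nzq : nonzero_at M q.
  apply: (@nonzero_at_s _ _ _ (op_rel B) x) => z; case: nz.
  by rewrite z lact0r.
have qj : factor_group (gT q) (gT j) by apply/factor_groupP; exists B.
have := card_isog (minj q nzq qj); rewrite !cardsT => cqj.
apply: onto_graph_aut; rewrite UE; apply: star_onto_graph => //.
by apply: onto_graph_bij => //; rewrite cqj.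
Qed.

Lemma Sb_inj i j (U V : {group gT i * gT j}) : Sb U = Sb V -> U = V.
Proof.
move/(congr1 (@sbasis_code I gT)) => /= /eqP; rewrite eq_Tagged /= => /eqP/eqP.
by rewrite eq_Tagged /= => /eqP.
Qed.

Lemma graphDelta_inj (E : finGroupType) (theta theta' : {perm E}) :
  theta \in Aut [set: E] -> theta' \in Aut [set: E] ->
  graphDelta theta = graphDelta theta' -> theta = theta'.
Proof.
move=> At At' e; apply/permP=> x; apply/eqP.
by rewrite -(in_graphAut _ _ At') -e in_graphAut.
Qed.

(** Every basis element of End(E) other than the graphs of automorphisms factors
    through a smaller group, where the module vanishes. *)
Lemma minimal_end M j a (x : M) : minimal_for M j -> at_group j x ->
  lact (one_ K gT j) (lact a x) =
  \sum_(theta in Aut [set: gT j])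
    a@_(Sb (graphDelta theta)) *: lact (s (graphDelta theta)) x.
Proof.
move=> minj xj; elim/sb_ind: a => [|c u a IH].
  by rewrite lact0l lact0r big1 // => theta _; rewrite mcoeff0 scale0r.
rewrite lactDl lactDr IH lactZl lactZr.
rewrite [RHS](eq_bigr (fun theta : {perm gT j} =>
    c *: ((u == Sb (graphDelta theta))%:R *: lact (s (graphDelta theta)) x) +
    a@_(Sb (graphDelta theta)) *: lact (s (graphDelta theta)) x)); last first.
  by move=> theta _; rewrite mcoeffD mcoeffZ mcoeff_sb scalerDl scalerA.
rewrite big_split -scaler_sumr /=.
suff -> : lact (one_ K gT j) (lact (sb u) x) =
    \sum_(theta in Aut [set: gT j])
      (u == Sb (graphDelta theta))%:R *: lact (s (graphDelta theta)) x by [].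
case: (pselect (exists2 theta, theta \in Aut [set: gT j] & u = Sb (graphDelta theta))).
  case=> theta At ->; rewrite (bigD1 theta) //= eqxx scale1r -lact_mul one_s //.
  rewrite big1 ?addr0 // => theta' /andP[At' /negPf ne].
  case: eqP => [/Sb_inj/(graphDelta_inj At At') e|_]; last by rewrite scale0r.
  by rewrite e eqxx in ne.
move=> no_theta; rewrite big1 => [|theta At].
  have [ul|ul] := eqVneq (sb_l u) j; last by rewrite one_act_sb.
  have [ur|ur] := eqVneq (sb_r u) j; last by rewrite (act_sb_at xj ur) lact0r.
  case: u ul ur no_theta => i' j' U /= ? ?; subst i' j' => no_theta.
  apply: contrapT => nz; apply: no_theta.
  have [|theta At ->] := @minimal_aut M j U x minj; last by exists theta.
  by move=> z; case: nz; rewrite z lact0r.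
by case: eqP => [e|_]; rewrite ?scale0r //; case: no_theta; exists theta.
Qed.

(** Two simple modules are isomorphic as soon as they share a nonzero space T
    on which, after cutting down by local units, the algebra acts in the same
    way: the submodule of their product generated by the diagonal copy of T
    is the graph of an isomorphism. *)
Section Linked.
Variables (T : lmodType K).

Definition linked M N (f : T -> M) (g : T -> N) := forall t, exists e,
  [/\ lact e (f t) = f t, lact e (g t) = g t & forall a t', exists t'',
     lact e (lact a (f t')) = f t'' /\ lact e (lact a (g t')) = g t''].

Definition diag_rel M N (f : T -> M) (g : T -> N) (x : M) (y : N) :=
  exists r : seq (L * T), x = \sum_(p <- r) lact p.1 (f p.2) /\
                          y = \sum_(p <- r) lact p.1 (g p.2).

Lemma linkedC M N (f : T -> M) (g : T -> N) : linked f g -> linked g f.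
Proof.
move=> fg t; have [e [e1 e2 e3]] := fg t; exists e; split=> // a t'.
by have [t'' []] := e3 a t'; exists t''.
Qed.

Lemma diag_relC M N (f : T -> M) (g : T -> N) x y :
  diag_rel f g x y -> diag_rel g f y x.
Proof. by case=> r []; exists r. Qed.

Section Half.
Variables (M N : Lmodule gT ell) (f : T -> M) (g : T -> N).
Hypotheses (simM : Lsimple M) (linf : linear f) (ling : linear g).
Hypotheses (injf : injective f) (injg : injective g).
Variables (t0 : T) (t0_neq0 : t0 <> 0).
Hypothesis fg : linked f g.

Lemma diag_rel0 : diag_rel f g 0 0.
Proof. by exists [::]; rewrite !big_nil. Qed.

Lemma diag_relP c x y x' y' : diag_rel f g x y -> diag_rel f g x' y' ->
  diag_rel f g (c *: x + x') (c *: y + y').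
Proof.
move=> [r [-> ->]] [r' [-> ->]]; exists ([seq (c *: p.1, p.2) | p <- r] ++ r').
rewrite !big_cat !big_map /= !scaler_sumr.
by split; congr (_ + _); apply: eq_bigr => p _; rewrite lactZl.
Qed.

Lemma diag_rel_act a x y : diag_rel f g x y -> diag_rel f g (lact a x) (lact a y).
Proof.
move=> [r [-> ->]]; exists [seq (a ** p.1, p.2) | p <- r].
by rewrite !big_map /= !lact_sumr; split; apply: eq_bigr => p _; rewrite lact_mul.
Qed.

Lemma diag_rel_base t : diag_rel f g (f t) (g t).
Proof.
by have [e [e1 e2 _]] := fg t; exists [:: (e, t)]; rewrite !big_seq1 e1 e2.
Qed.

Lemma diag_rel_surj x : exists y, diag_rel f g x y.
Proof.
have [] := simM.2 (fun x => exists y, diag_rel f g x y).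
- split=> [|c x1 x2 [y1 r1] [y2 r2]|a x1 [y1 r1]].
  + by exists 0; apply: diag_rel0.
  + by exists (c *: y1 + y2); apply: diag_relP.
  + by exists (lact a y1); apply: diag_rel_act.
- move=> all0; case: t0_neq0; apply: injf; rewrite (lin0 linf); apply: all0.
  by exists (g t0); apply: diag_rel_base.
- exact.
Qed.

Lemma diag_rel_ker x : diag_rel f g x 0 -> x = 0.
Proof.
have [] := simM.2 (fun x => diag_rel f g x 0).
- split=> [|c x1 x2 r1 r2|a x1 r1]; first exact: diag_rel0.
  + by have := diag_relP c r1 r2; rewrite scaler0 addr0.
  + by have := diag_rel_act a r1; rewrite lact0r.
- by move=> all0; apply: all0.
move=> allM; have [r [ft0 g0]] := allM (f t0).
(* Otherwise the pair (f t0, 0) is a combination of diagonal elements; cut down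
   by e, it becomes the diagonal element of some t, and g t = 0. *)
have [e [e1 _ e3]] := fg t0; case: t0_neq0; apply: injf; rewrite (lin0 linf).
have [t [ft gt]] : exists t, lact e (\sum_(p <- r) lact p.1 (f p.2)) = f t /\
                             lact e (\sum_(p <- r) lact p.1 (g p.2)) = g t.
  elim: {ft0 g0} r => [|p r [t [ft gt]]].
    by exists 0; rewrite !big_nil !lact0r (lin0 linf) (lin0 ling).
  have [t' [ft' gt']] := e3 p.1 p.2; exists (t' + t).
  by rewrite !big_cons !lactDr ft gt ft' gt' (linD linf) (linD ling).
rewrite -e1 ft0 ft; rewrite -g0 lact0r in gt.
by rewrite (injg (etrans (esym gt) (esym (lin0 ling)))) (lin0 linf).
Qed.

Lemma diag_rel_unique x x' y : diag_rel f g x y -> diag_rel f g x' y -> x = x'.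
Proof.
move=> r r'; have := diag_relP (-1) r r'; rewrite !scaleN1r addNr => /diag_rel_ker.
by move/eqP; rewrite addrC subr_eq0 => /eqP.
Qed.
End Half.

Lemma linked_iso M N (f : T -> M) (g : T -> N) (t0 : T) : Lsimple M -> Lsimple N ->
  linear f -> linear g -> injective f -> injective g -> t0 <> 0 ->
  linked f g -> Liso M N.
Proof.
move=> simM simN linf ling injf injg nz fg; have gf := linkedC fg.
pose h x := sval (cid (diag_rel_surj simM linf injf nz fg x)).
have hP x : diag_rel f g x (h x) by rewrite /h; case: cid.
pose k y := sval (cid (diag_rel_surj simN ling injg nz gf y)).
have kP y : diag_rel g f y (k y) by rewrite /k; case: cid.
have hU x y : diag_rel f g x y -> h x = y.
  move=> r; apply: (diag_rel_unique simN ling linf injg injf nz gf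
    (diag_relC (hP x)) (diag_relC r)).
exists h; split.
- by move=> c x y; apply/hU/diag_relP.
- exists k => [x|y].
    exact: (diag_rel_unique simM linf ling injf injg nz fg (diag_relC (kP _)) (hP x)).
  exact/hU/diag_relC.
- by move=> a x; apply/hU/diag_rel_act.
Qed.
End Linked.

(** ** The module of automorphisms at a minimal group *)

Definition iso_res M j n (W : mx_representation K (Aut_group [set: gT j]) n) :=
  exists f : 'rV[K]_n -> M,
    [/\ linear f, injective f, forall y, at_group j y <-> exists w, f w = y
      & forall theta, theta \in Aut [set: gT j] -> forall w,
          f (w *m W theta) = lact (s (graphDelta theta)) (f w)].

(** The action of the cut-down algebra on W, killing every basis element that
    is not the graph of an automorphism. *)
Definition aut_act j n (W : mx_representation K (Aut_group [set: gT j]) n)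
    (a : L) (w : 'rV[K]_n) : 'rV[K]_n :=
  \sum_(theta in Aut [set: gT j]) a@_(Sb (graphDelta theta)) *: (w *m W theta).

Lemma res_end M j n (W : mx_representation K (Aut_group [set: gT j]) n)
    (f : 'rV[K]_n -> M) a w : linear f -> minimal_for M j -> at_group j (f w) ->
  (forall theta, theta \in Aut [set: gT j] -> forall w,
     f (w *m W theta) = lact (s (graphDelta theta)) (f w)) ->
  lact (one_ K gT j) (lact a (f w)) = f (aut_act W a w).
Proof.
move=> linf minj fj fW; rewrite minimal_end // (lin_sum linf).
by apply: eq_bigr => theta At; rewrite (linZ linf) fW.
Qed.

Lemma iso_res_unique M N j n (W : mx_representation K (Aut_group [set: gT j]) n) :
  Lsimple M -> Lsimple N -> minimal_for M j -> minimal_for N j ->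
  iso_res M W -> iso_res N W -> Liso M N.
Proof.
move=> simM simN minM minN [f [linf injf imf fW]] [g [ling injg img gW]].
have fj w : at_group j (f w) by apply/imf; exists w.
have gj w : at_group j (g w) by apply/img; exists w.
have [x [/imf[t ft] nzx]] := minM.1.
apply: (linked_iso simM simN linf ling injf injg (t0 := t)).
  by move=> t0; case: nzx; rewrite -ft t0 (lin0 linf).
move=> w; exists (one_ K gT j); split; try exact/at_groupP.
by move=> a w'; exists (aut_act W a w'); rewrite !(res_end (W := W)).
Qed.
End Modules.
(** * Constructing modules *)

Section SubspaceType.
Variables (K : fieldType) (V : lmodType K) (S : submodClosed V).

Record subspace_of := SubspaceOf { subspace_val :> V; _ : subspace_val \in S }.
HB.instance Definition _ := [isSub for subspace_val].
HB.instance Definition _ := [Choice of subspace_of by <:].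
HB.instance Definition _ := [SubChoice_isSubLmodule of subspace_of by <:].
End SubspaceType.

Section PropSubspace.
Variables (K : fieldType) (V : lmodType K) (P : V -> Prop).
Hypotheses (P0 : P 0) (PD : forall (c : K) x y, P x -> P y -> P (c *: x + y)).

Definition prop_pred : {pred V} := fun v => `[< P v >].

Lemma prop_pred_closed : submod_closed prop_pred.
Proof.
split=> [|c x y]; first exact/asboolP.
by move=> /asboolP Px /asboolP Py; apply/asboolP/PD.
Qed.
HB.instance Definition _ := GRing.isSubmodClosed.Build K V prop_pred prop_pred_closed.

Definition prop_submod : submodClosed V := prop_pred.

Lemma prop_submodP v : v \in prop_submod <-> P v.
Proof. by split=> /asboolP. Qed.
End PropSubspace.

Section SubModule.
Variables (K : fieldType) (I : choiceType) (gT : I -> finGroupType).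
Variables (ell : nat -> K) (V : lmodType K).
Local Notation L := (Lambda K gT).
Local Notation "a ** b" := (lmul ell a b) (at level 40, left associativity).
Variables (act : L -> V -> V) (P : V -> Prop).
Hypotheses (P0 : P 0) (PD : forall (c : K) x y, P x -> P y -> P (c *: x + y)).
Hypothesis actP : forall a x, P x -> P (act a x).
Hypothesis act_linl : forall x, P x -> linear (act^~ x).
Hypothesis act_linr : forall a, linear (act a).
Hypothesis act_mul : forall a b x, P x -> act (a ** b) x = act a (act b x).
Hypothesis act_unit : forall x, P x -> exists e, e ** e = e /\ act e x = x.

(** The ambient space V is typically a space of functions on the algebra, on
    which linearity in the algebra and local units are available only for the
    functions in P. *)
Lemma subspace_module : exists (M : Lmodule gT ell) (val : M -> V),
  [/\ linear val, injective val, forall v, P v <-> exists x, val x = v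
    & forall a x, val (lact a x) = act a (val x)].
Proof.
pose C := subspace_of (prop_submod P0 PD).
have CP (x : C) : P x by case: x => v /= /(prop_submodP P0 PD).
have inP v : P v -> v \in prop_submod P0 PD by move/(prop_submodP P0 PD).
pose ca a (x : C) : C := SubspaceOf (inP _ (actP a (CP x))).
have linl m : linear (ca^~ m).
  by move=> c a b; apply: val_inj; rewrite /= act_linl.
have linr a : linear (ca a).
  by move=> c x y; apply: val_inj; rewrite /= act_linr.
have caM a b m : ca (Lmul ell a b) m = ca a (ca b m).
  by apply: val_inj; rewrite /= (_ : Lmul ell a b = a ** b) ?act_mul // unlock.
have idem m : exists e, Lmul ell e e = e /\ ca e m = m.
  have [e [ee em]] := act_unit (CP m); exists e; split; last exact: val_inj.
  by rewrite -{3}ee unlock.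
exists (LModule linl linr caM idem), (@subspace_val _ _ _); split=> //.
  exact: val_inj.
by move=> v; split=> [Pv|[x <-] //]; exists (SubspaceOf (inP _ Pv)).
Qed.
End SubModule.

Section Induction.
Variables (K : fieldType) (I : choiceType) (gT : I -> finGroupType).
Variable ell : nat -> K.
Hypothesis ell_hom : monoid_hom ell.
Local Notation L := (Lambda K gT).
Local Notation "a ** b" := (lmul ell a b) (at level 40, left associativity).
Variables (T : lmodType K) (rho : L -> T -> T) (good : L -> Prop).
Hypothesis rho_linl : forall t, linear (rho^~ t).
Hypothesis rho_linr : forall a, linear (rho a).
Hypothesis rho_good : forall e c y t, good e ->
  rho (c ** e ** y) t = rho c (rho e (rho y t)).
Hypothesis good_unit : forall t, exists e, good e /\ rho e t = t.
Hypothesis T_nonzero : exists t : T, t <> 0.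
Hypothesis T_irr : forall Q : T -> Prop, Q 0 ->
  (forall (c : K) x y, Q x -> Q y -> Q (c *: x + y)) ->
  (forall a x, Q x -> Q (rho a x)) -> (forall x, Q x -> x = 0) \/ (forall x, Q x).

Let ev (t : T) : L -> T := fun b => rho b t.
Let act (c : L) (F : L -> T) : L -> T := fun b => F (b ** c).
Let P (F : L -> T) := exists r : seq (L * T),
  forall b, F b = \sum_(p <- r) rho (b ** p.1) p.2.

(** Green's construction: T is a simple module for a corner of the algebra, cut
    out by elements called good, and rho extends its action by 0 outside the
    corner. The simple module over the whole algebra extending T is the image
    of the induced module in the coinduced one, that is, the module of
    functions on the algebra generated by the functions b |-> rho b t. *)
Lemma green_module : exists (M : Lmodule gT ell) (iota : T -> M),
  [/\ Lsimple M, linear iota, injective iota,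
      forall y, exists r : seq (L * T), y = \sum_(p <- r) lact p.1 (iota p.2)
    & forall e b t, good e -> lact (e ** b) (iota t) = iota (rho e (rho b t))].
Proof.
have P0 : P 0 by exists [::] => b; rewrite big_nil.
have PD (c : K) F G : P F -> P G -> P (c *: F + G).
  move=> [r Fr] [r' Gr]; exists ([seq (p.1, c *: p.2) | p <- r] ++ r') => b.
  rewrite big_cat big_map /= -Gr; have -> : (c *: F + G) b = c *: F b + G b by [].
  rewrite Fr scaler_sumr; congr (_ + _); apply: eq_bigr => p _.
  by rewrite (linZ (rho_linr _)).
have actP a F : P F -> P (act a F).
  move=> [r Fr]; exists [seq (a ** p.1, p.2) | p <- r] => b.
  by rewrite /act Fr big_map; apply: eq_bigr => p _; rewrite LmulA.
have linP F : P F -> linear F.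
  move=> [r Fr] c a b; rewrite !Fr scaler_sumr -big_split; apply: eq_bigr => p _.
  by rewrite /= LmulDl LmulZl (linD (rho_linl _)) (linZ (rho_linl _)).
have act_linl F : P F -> linear (act^~ F).
  move=> PF c a b; apply/funext => x.
  by rewrite /act LmulDr LmulZr (linP F PF).
have act_linr a : linear (act a) by [].
have act_mul a b F : P F -> act (a ** b) F = act a (act b F).
  by move=> PF; apply/funext => x; rewrite /act LmulA.
have act_unit F : P F -> exists e, e ** e = e /\ act e F = F.
  move=> [r Fr]; have [e [ee er]] := local_unit ell_hom [seq p.1 | p <- r].
  exists e; split=> //; apply/funext => b; rewrite /act !Fr.
  by apply: eq_big_seq => p pr; rewrite -LmulA // er // map_f.
have [M [val [vlin vinj vP vact]]] :=
  subspace_module P0 PD actP act_linl act_linr act_mul act_unit.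
have Pev t : P (ev t).
  (* The good element e is needed once to split rho (b ** e ** e) and once more
     as the factor y of rho_good. *)
  have [e [ge et]] := good_unit t; exists [:: (e ** e, t)] => b.
  by rewrite big_seq1 /= LmulA // rho_good // !et.
have ex_iota t : exists x, val x = ev t by apply/vP/Pev.
pose iota t := sval (cid (ex_iota t)).
have iotaE t : val (iota t) = ev t by rewrite /iota; case: cid.
have ilin : linear iota.
  move=> c x y; apply: vinj; rewrite vlin !iotaE; apply/funext => b.
  exact: rho_linr.
have iinj : injective iota.
  move=> x y e; have {}e : ev x = ev y by rewrite -!iotaE e.
  have [d [gd dxy]] := good_unit (x - y).
  apply/eqP; rewrite -subr_eq0 -dxy; apply/eqP.
  rewrite (linD (rho_linr _)) -scaleN1r (linZ (rho_linr _)) scaleN1r.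
  by rewrite -[rho d x]/(ev x d) e addrN.
have igen y : exists r : seq (L * T), y = \sum_(p <- r) lact p.1 (iota p.2).
  have [r yr] : P (val y) by apply/vP; exists y.
  exists r; apply: vinj; rewrite (lin_sum vlin); apply/funext => b.
  rewrite yr fct_sumE; apply: eq_bigr => p _.
  by rewrite vact iotaE.
have igood e b t : good e -> lact (e ** b) (iota t) = iota (rho e (rho b t)).
  move=> ge; apply: vinj; rewrite vact !iotaE; apply/funext => c.
  by rewrite /act /ev LmulA // rho_good.
exists M, iota; split=> //; split.
  have [t nzt] := T_nonzero; exists (iota t) => i0; apply: nzt.
  by apply: iinj; rewrite i0 (lin0 ilin).
move=> Q [Q0 QD QA]; case: (pselect (forall x, Q x -> x = 0)); first by left.
move=> nQ; right; have [y Qy nzy] : exists2 y, Q y & y <> 0.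
  by apply: contrapT => no; apply: nQ => x Qx; apply: contrapT => nz; apply: no; exists x.
(* A value of y at b is a nonzero vector t of T, and multiplying y by b and then
   by a good element fixing t gives iota t. *)
have [b nzb] : exists b, val y b <> 0.
  apply: contrapT => no; apply: nzy; apply: vinj; rewrite (lin0 vlin).
  by apply/funext => b; apply: contrapT => nz; apply: no; exists b.
have [r yr] : P (val y) by apply/vP; exists y.
have [e [ge eb]] := good_unit (val y b).
have Qb : Q (iota (val y b)).
  suff -> : iota (val y b) = lact (e ** b) y by apply: QA.
  apply: vinj; rewrite iotaE vact; apply/funext => c.
  rewrite /ev /act -{1}eb yr (lin_sum (rho_linr e)) (lin_sum (rho_linr c)) yr.
  by apply: eq_bigr => p _; rewrite -rho_good // !LmulA.
have allQ : forall t, Q (iota t).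
  have [] // := T_irr (Q := fun t => Q (iota t)).
  - by rewrite (lin0 ilin).
  - by move=> c t t' Qt Qt'; rewrite ilin; apply: QD.
  - move=> a t Qt; have [d [gd dt]] := good_unit (rho a t).
    by rewrite -dt -igood //; apply: QA.
  by move=> all0; case: nzb; apply: all0.
move=> z; have [r' ->] := igen z.
elim: r' => [|p r' IH]; first by rewrite big_nil.
rewrite big_cons -[lact _ _]scale1r; apply: QD => //.
exact: QA.
Qed.

End Induction.
(** * From seeds to modules *)

Section Representations.
Variables (K : fieldType) (gT : finGroupType) (G : {group gT}) (n : nat).
Variable W : mx_representation K G n.

Lemma irr_span (w v : 'rV[K]_n) : mx_irreducible W -> w <> 0 ->
  exists c : gT -> K, v = \sum_(g in G) c g *: (w *m W g).
Proof.
move=> irrW /eqP nzw.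
have sW := mxsimple_cyclic irrW nzw (submx1 w).
have /cyclic_mxP[A /envelop_mxP[c ->] ->] : (v <= cyclic_mx W w)%MS.
  by rewrite -sW submx1.
exists c; rewrite mulmx_sumr; apply: eq_bigr => g _.
by rewrite scalemxAr.
Qed.

(** Irreducibility is about submodules given by matrices; spanning by orbits
    extends it to stable subspaces given by a mere proposition. *)
Lemma irr_prop (Q : 'rV[K]_n -> Prop) : mx_irreducible W -> Q 0 ->
  (forall (c : K) x y, Q x -> Q y -> Q (c *: x + y)) ->
  (forall g x, g \in G -> Q x -> Q (x *m W g)) ->
  (forall x, Q x -> x = 0) \/ (forall x, Q x).
Proof.
move=> irrW Q0 QD QW; case: (pselect (forall x, Q x -> x = 0)); first by left.
move=> nQ; right => v.
have [w Qw nzw] : exists2 w, Q w & w <> 0.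
  by apply: contrapT => no; apply: nQ => x Qx; apply: contrapT => nz; apply: no; exists x.
have [c ->] := irr_span v irrW nzw.
elim/big_ind: _ => // [x y Qx Qy|g Gg]; first by rewrite -[x]scale1r; apply: QD.
by rewrite -[_ *: _]addr0; apply: QD => //; apply: QW.
Qed.

Lemma irr_nonzero : mx_irreducible W -> exists w : 'rV[K]_n, w <> 0.
Proof.
case=> _ nz1 _; have [i nzi] : exists i, row i (1%:M : 'M[K]_n) != 0.
  apply/existsP; apply: contraNT nz1; rewrite negb_exists => /forallP all0.
  by apply/eqP/row_matrixP => i; rewrite row0; apply/eqP; rewrite -[_ == _]negbK.
by exists (row i 1%:M); apply/eqP.
Qed.

End Representations.

Section AutAction.
Variables (K : fieldType) (I : choiceType) (gT : I -> finGroupType).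
Variable ell : nat -> K.
Hypothesis ell_hom : monoid_hom ell.
Local Notation L := (Lambda K gT).
Local Notation sb := (@sb K I gT).
Local Notation s U := (sb (Sb U)).
Local Notation "a ** b" := (lmul ell a b) (at level 40, left associativity).
Variables (j : I) (n : nat).
Variable W : mx_representation K (Aut_group [set: gT j]) n.

Lemma aut_act_linl w : linear (fun a : L => aut_act W a w).
Proof.
move=> c a b; rewrite /aut_act scaler_sumr -big_split; apply: eq_bigr => theta _.
by rewrite /= mcoeffD mcoeffZ scalerDl scalerA.
Qed.

Lemma aut_act_linr (a : L) : linear (aut_act W a).
Proof.
move=> c x y; rewrite /aut_act scaler_sumr -big_split; apply: eq_bigr => theta _.
by rewrite /= mulmxDl -scalemxAl scalerDr !scalerA mulrC.
Qed.

Lemma aut_act_graph theta w : theta \in Aut [set: gT j] ->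
  aut_act W (s (graphDelta theta)) w = w *m W theta.
Proof.
move=> At; rewrite /aut_act (bigD1 theta) //= mcoeff_sb eqxx scale1r.
rewrite big1 ?addr0 // => theta' /andP[At' /negPf ne]; rewrite mcoeff_sb.
case: eqP => [/Sb_inj/(graphDelta_inj At At') e|_]; last by rewrite scale0r.
by rewrite e eqxx in ne.
Qed.

Lemma aut_act_other u w :
  (forall theta, theta \in Aut [set: gT j] -> u <> Sb (graphDelta theta)) ->
  aut_act W (sb u) w = 0.
Proof.
move=> no; rewrite /aut_act big1 // => theta At; rewrite mcoeff_sb.
by case: eqP => [/no|_]; rewrite ?scale0r // => /(_ At).
Qed.

Lemma graphDelta1 (E : finGroupType) :
  graphDelta (@id E) = graphDelta (1%g : {perm E}).
Proof. by apply: group_relP => a b; rewrite in_graph1 in_graphAut ?group1 // perm1. Qed.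

Lemma aut_act1 w : aut_act W (one_ K gT j) w = w.
Proof. by rewrite /one_ graphDelta1 aut_act_graph ?group1 // repr_mx1 mulmx1. Qed.

Lemma star_graphM (E : finGroupType) (a b : {perm E}) :
  a \in Aut [set: E] -> b \in Aut [set: E] ->
  star (graphDelta a) (graphDelta b) = graphDelta (b * a)%g.
Proof.
move=> Aa Ab; apply: group_relP => x y; rewrite in_graphAut ?groupM // permM.
split=> [/starP[z []]|/eqP->].
  by rewrite !in_graphAut // => /eqP-> /eqP->.
by apply/starP; exists (b y); rewrite !in_graphAut.
Qed.

Lemma Aut1 (E : finGroupType) (theta : {perm E}) :
  theta \in Aut [set: E] -> theta 1%g = 1%g.
Proof. by move=> At; apply: (mulgI (theta 1%g)); rewrite -AutM // !mulg1. Qed.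

(** An element related to 1 by one of the factors is related to 1 by the product,
    hence trivial; and every element of E is met because the product is total
    on both sides. *)
Lemma star_graph_inv (E F : finGroupType) (U : {group E * F}) (V : {group F * E})
    theta : theta \in Aut [set: E] -> star U V = graphDelta theta ->
  onto_graph V /\ onto_graph (op_rel U).
Proof.
move=> At UV; have t1 := Aut1 At.
have inUV x y : (x, y) \in star U V = (x == theta y) by rewrite UV in_graphAut.
split; split=> x.
- move=> Vx; have : (1%g, x) \in star U V by apply/starP; exists 1%g; rewrite group1.
  by rewrite inUV -[X in X == _]t1 => /eqP/perm_inj.
- have /starP[g [_ Vg]] : (theta x, x) \in star U V by rewrite inUV.
  by exists g.
- rewrite in_op_rel => Ux.
  have : (x, 1%g) \in star U V by apply/starP; exists 1%g; rewrite group1.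
  by rewrite inUV t1 => /eqP.
have /starP[g [Ug _]] : (x, theta^-1%g x) \in star U V by rewrite inUV permKV.
by exists g; rewrite in_op_rel.
Qed.

(** A product of relations on E is the graph of an automorphism only if both
    factors are, so the non-automorphisms span an ideal of End(E). *)
Lemma aut_act_good c y w :
  aut_act W (c ** one_ K gT j ** y) w =
  aut_act W c (aut_act W (one_ K gT j) (aut_act W y w)).
Proof.
rewrite aut_act1; elim/sb_ind: c => [|z u c IH].
  by rewrite !Lmul0l !(lin0 (aut_act_linl _)).
rewrite !LmulDl !LmulZl !(linD (aut_act_linl _)) !(linZ (aut_act_linl _)) IH.
suff -> : aut_act W (sb u ** one_ K gT j ** y) w = aut_act W (sb u) (aut_act W y w) by [].
elim/sb_ind: y {IH z c} => [|z v y IH].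
  by rewrite Lmul0r !(lin0 (aut_act_linl _)) (lin0 (aut_act_linr _)).
rewrite !LmulDr !LmulZr !(linD (aut_act_linl _)) !(linZ (aut_act_linl _)) IH.
rewrite (linD (aut_act_linr _)) (linZ (aut_act_linr _)).
suff -> : aut_act W (sb u ** one_ K gT j ** sb v) w =
          aut_act W (sb u) (aut_act W (sb v) w) by [].
have zero_u : (sb_l u != j) || (sb_r u != j) -> forall x, aut_act W (sb u) x = 0.
  by move=> ne x; apply: aut_act_other => theta _ e; move: ne; rewrite e /= !eqxx.
have zero_v : (sb_l v != j) || (sb_r v != j) -> forall x, aut_act W (sb v) x = 0.
  by move=> ne x; apply: aut_act_other => theta _ e; move: ne; rewrite e /= !eqxx.
rewrite sb_mul_one //; have [ur|ur] := eqVneq (sb_r u) j; last first.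
  by rewrite Lmul0l (lin0 (aut_act_linl _)) zero_u // ur orbT.
have [vl|vl] := eqVneq (sb_l v) j; last first.
  rewrite Lmul_sb0 ?(lin0 (aut_act_linl _)) ?ur 1?eq_sym //.
  by rewrite zero_v ?vl // (lin0 (aut_act_linr _)).
case: u v ur vl zero_u zero_v {IH} => i j' U [j'' k V] /= ? ?; subst j' j''.
have [?|ne] := eqVneq i j; last first.
  move=> -> // _; rewrite Lmul_s (linZ (aut_act_linl _)) aut_act_other ?scaler0 //.
  by move=> theta _ /(congr1 (@sb_l _ _)) /= e; rewrite e eqxx in ne.
have [?|ne] := eqVneq k j; last first.
  move=> _ ->; rewrite ?orbT // (lin0 (aut_act_linr _)) Lmul_s (linZ (aut_act_linl _)).
  rewrite aut_act_other ?scaler0 //.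
  by move=> theta _ /(congr1 (@sb_r _ _)) /= e; rewrite e eqxx in ne.
subst i k => _ _.
case: (pselect (onto_graph V /\ onto_graph (op_rel U))) => [[oV oU]|no].
  have [t At ->] := onto_graph_aut oV.
  have [t' At' ->] : exists2 t, t \in Aut [set: gT j] & U = graphDelta t.
    apply: onto_graph_aut; suff -> : U = op_rel (op_rel U) by apply: onto_graph_bij.
    by apply: group_relP => f g; rewrite !in_op_rel.
  rewrite s_star // ?star_graphM // ?aut_act_graph ?groupM //.
    by rewrite repr_mxM // mulmxA.
  by move=> g; rewrite !in_graphAut // => _ /eqP ->; apply: Aut1.
transitivity (0 : 'rV[K]_n).
  rewrite Lmul_s (linZ (aut_act_linl _)) aut_act_other ?scaler0 //.
  by move=> theta At /Sb_inj /(star_graph_inv At).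
case: (pselect (onto_graph V)) => [oV|noV]; last first.
  rewrite (aut_act_other (u := Sb V)) ?(lin0 (aut_act_linr _)) // => t At /Sb_inj e.
  apply: noV; rewrite e; split=> x; rewrite ?in_graphAut //.
    by rewrite -[X in X == _](Aut1 At) => /eqP/perm_inj.
  by exists (t x); rewrite in_graphAut.
rewrite aut_act_other // => t At /Sb_inj e; apply: no; split=> //.
rewrite e; split=> x; rewrite ?in_op_rel ?in_graphAut //.
  by move/eqP->; apply: Aut1.
by exists (t^-1%g x); rewrite in_op_rel in_graphAut // permKV.
Qed.

Lemma aut_act_left k (U : {group gT j * gT k}) a w :
  (forall (t : {perm gT j}) (V : {group gT k * gT j}),
     t \in Aut [set: gT j] -> star U V <> graphDelta t) ->
  aut_act W (s U ** a) w = 0.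
Proof.
move=> no; elim/sb_ind: a => [|z v a IH].
  by rewrite Lmul0r (lin0 (aut_act_linl _)).
rewrite LmulDr LmulZr (linD (aut_act_linl _)) (linZ (aut_act_linl _)) IH addr0.
have [vl|vl] := eqVneq (sb_l v) k; last first.
  by rewrite Lmul_sb0 1?eq_sym // (lin0 (aut_act_linl _)) scaler0.
case: v vl => k' l V /= ?; subst k'.
rewrite Lmul_s (linZ (aut_act_linl _)) aut_act_other ?scaler0 // => t At.
have [?|ne] := eqVneq l j; first by subst l => /Sb_inj; apply: no.
by move=> /(congr1 (@sb_r _ _)) /= e; rewrite e eqxx in ne.
Qed.

(** Green's construction for the corner id_E Lambda id_E acting on W through the
    graphs of automorphisms. If the module lives at a factor group G of E, then
    some product of relations from E to G and back acts on W, hence is the graph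
    of an automorphism, and E is a factor group of G. *)
Lemma simple_of_aut_rep : mx_irreducible W ->
  exists M : Lmodule gT ell, [/\ Lsimple M, minimal_for M j & iso_res M W].
Proof.
move=> irrW.
have stable (Q : 'rV[K]_n -> Prop) : Q 0 ->
    (forall (c : K) x y, Q x -> Q y -> Q (c *: x + y)) ->
    (forall (a : L) x, Q x -> Q (aut_act W a x)) ->
    (forall x, Q x -> x = 0) \/ (forall x, Q x).
  move=> Q0 QD QA; apply: (irr_prop irrW) => // g x Ag Qx.
  by rewrite -aut_act_graph //; apply: QA.
have [|t|M [f [simM linf injf genf fgood]]] :=
    green_module (good := fun e => e = one_ K gT j) ell_hom aut_act_linl aut_act_linr
      _ _ (irr_nonzero irrW) stable.
- by move=> e c y t ->; apply: aut_act_good.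
- by exists (one_ K gT j); rewrite aut_act1.
have fone b t : lact (one_ K gT j ** b) (f t) = f (aut_act W b t).
  by rewrite fgood // aut_act1.
have fj w : lact (one_ K gT j) (f w) = f w.
  by rewrite -{1}(one_one gT ell_hom j) fone aut_act1.
have one_gen b (r : seq (L * 'rV[K]_n)) :
    lact (one_ K gT j ** b) (\sum_(p <- r) lact p.1 (f p.2)) =
    f (\sum_(p <- r) aut_act W (b ** p.1) p.2).
  rewrite lact_sumr (lin_sum linf); apply: eq_bigr => p _.
  by rewrite -lact_mul -LmulA // fone.
exists M; split=> //.
  have [w nzw] := irr_nonzero irrW; have nzf : f w <> 0.
    by rewrite -(lin0 linf) => /injf.
  have fwj : at_group j (f w) by apply/(at_groupP ell_hom).
  split=> [|k [y [yk nzy]] kj]; first by exists (f w).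
  apply: factor_group_anti => //.
  have [U] := simple_link ell_hom simM yk nzy fwj nzf.
  have [r ->] := genf y => nzU.
  case: (pselect (exists (t : {perm gT j}) (V : {group gT k * gT j}),
      t \in Aut [set: gT j] /\ star U V = graphDelta t)).
    move=> [t [V [At /(star_graph_inv At)[oV _]]]].
    by apply/factor_groupP; exists V.
  move=> no; case: nzU; rewrite -[s U](one_s ell_hom) one_gen big1 ?(lin0 linf) //.
  move=> p _; apply: aut_act_left => t V At e; apply: no.
  by exists t, V.
exists f; split=> //.
  move=> y; split=> [/(at_groupP ell_hom) <-|[w <-]]; last exact/(at_groupP ell_hom).
  have [r ->] := genf y; rewrite -(one_one gT ell_hom j) one_gen.
  by exists (\sum_(p <- r) aut_act W (one_ K gT j ** p.1) p.2).
move=> theta At w; rewrite -aut_act_graph // -fone.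
by rewrite (one_s ell_hom).
Qed.
End AutAction.
(** * The subalgebra of a subfamily *)

HB.lock Definition emb (K : fieldType) (I I' : choiceType) (gT : I -> finGroupType)
  (gT' : I' -> finGroupType) (a : Lambda K gT) : Lambda K (ext_family gT gT') :=
  embed gT' a.
Canonical emb_unlockable := Unlockable emb.unlock.

Definition proj_basis (K : fieldType) (I I' : choiceType) (gT : I -> finGroupType)
    (gT' : I' -> finGroupType) (u : sbasis (ext_family gT gT')) : Lambda K gT :=
  match sb_l u as x, sb_r u as y
    return {group ext_family gT gT' x * ext_family gT gT' y} -> Lambda K gT with
  | inl i, inl k => fun U : {group gT i * gT k} => sb K (Sb U)
  | _, _ => fun _ => 0
  end (sb_grp u).

(** The projection onto a corner: it is multiplicative only for products whose
    middle index lies in the small family. *)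
HB.lock Definition proj (K : fieldType) (I I' : choiceType) (gT : I -> finGroupType)
  (gT' : I' -> finGroupType) (a : Lambda K (ext_family gT gT')) : Lambda K gT :=
  lext (@proj_basis K I I' gT gT') a.
Canonical proj_unlockable := Unlockable proj.unlock.

Section Extension.
Variables (K : fieldType) (I I' : choiceType).
Variables (gT : I -> finGroupType) (gT' : I' -> finGroupType).
Variable ell : nat -> K.
Hypothesis ell_hom : monoid_hom ell.
Local Notation gX := (ext_family gT gT').
Local Notation L := (Lambda K gT).
Local Notation LX := (Lambda K gX).
Local Notation sb := (@sb K _ _).
Local Notation s U := (sb (Sb U)).
Local Notation "a ** b" := (lmul ell a b) (at level 40, left associativity).
Local Notation emb := (@emb K I I' gT gT').
Local Notation proj := (@proj K I I' gT gT').
Local Notation proj_basis := (@proj_basis K I I' gT gT').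
Local Notation embB := (@embed_basis I I' gT gT').

Lemma embE a : embed gT' a = emb a. Proof. by rewrite unlock. Qed.

Lemma embedE a : emb a = lext (fun u => sb (embB u)) a.
Proof. by rewrite !unlock. Qed.

Lemma embed_linear : linear emb.
Proof. by move=> c a b; rewrite !embedE linearP. Qed.

Lemma embed_sb u : emb (sb u) = sb (embB u).
Proof. by rewrite embedE lext_sb. Qed.

Lemma proj_linear : linear proj.
Proof. by move=> c a b; rewrite unlock linearP. Qed.

Lemma proj_sb u : proj (sb u) = proj_basis u.
Proof. by rewrite unlock lext_sb. Qed.

Lemma proj_embed_sb u : proj (sb (embB u)) = sb u.
Proof. by rewrite proj_sb; case: u. Qed.

Lemma proj_embed a : proj (emb a) = a.
Proof.
elim/sb_ind: a => [|c u a IH]; first by rewrite (lin0 embed_linear) (lin0 proj_linear).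
by rewrite embed_linear proj_linear IH embed_sb proj_embed_sb.
Qed.

Lemma proj_mul_l i k (U : {group gX (inl i) * gX (inl k)}) v :
  proj (sb (Sb U) ** sb v) = proj (sb (Sb U)) ** proj (sb v).
Proof.
have [vl|ne] := eqVneq (sb_l v) (inl k); last first.
  rewrite Lmul_sb0 1?eq_sym // (lin0 proj_linear) !proj_sb.
  case: v ne => [[k'|k'] [l|l] V] /= ne; rewrite ?Lmul0r //.
  by rewrite Lmul_sb0 // eq_sym.
case: v vl => x y V /= ?; subst x.
rewrite Lmul_s (linZ proj_linear) !proj_sb.
by case: y V => [l|l] V; rewrite /= ?Lmul0r ?scaler0 // Lmul_s.
Qed.

Lemma proj_mul_r i k u (V : {group gX (inl i) * gX (inl k)}) :
  proj (sb u ** sb (Sb V)) = proj (sb u) ** proj (sb (Sb V)).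
Proof.
have [ur|ne] := eqVneq (sb_r u) (inl i); last first.
  rewrite Lmul_sb0 // (lin0 proj_linear) !proj_sb.
  case: u ne => [[k'|k'] [l|l] U] /= ne; rewrite ?Lmul0l //.
  by rewrite Lmul_sb0.
case: u ur => x y U /= ?; subst y.
rewrite Lmul_s (linZ proj_linear) !proj_sb.
by case: x U => [l|l] U; rewrite /= ?Lmul0l ?scaler0 // Lmul_s.
Qed.

Lemma proj_embed_mul a y : proj (emb a ** y) = a ** proj y.
Proof.
move: a; apply: sb_eq_linear => [||u].
- exact: lin_comp proj_linear (lin_comp (Lmul_linearl _ _) embed_linear).
- exact: Lmul_linearl.
rewrite embed_sb; move: y; apply: sb_eq_linear => [||v].
- exact: lin_comp proj_linear (Lmul_linearr _ _).
- exact: lin_comp (Lmul_linearr _ _) proj_linear.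
by rewrite -[in RHS]proj_embed_sb; apply: proj_mul_l.
Qed.

Lemma proj_mul_embed a c y : proj (c ** emb a ** y) = proj c ** (a ** proj y).
Proof.
rewrite -proj_embed_mul -LmulA //.
move: c; apply: sb_eq_linear => [||w].
- exact: lin_comp proj_linear (Lmul_linearl _ _).
- exact: lin_comp (Lmul_linearl _ _) proj_linear.
move: a; apply: sb_eq_linear => [||u].
- exact: lin_comp proj_linear
    (lin_comp (Lmul_linearr _ _) (lin_comp (Lmul_linearl _ _) embed_linear)).
- exact: lin_comp (Lmul_linearr _ _)
    (lin_comp proj_linear (lin_comp (Lmul_linearl _ _) embed_linear)).
rewrite embed_sb; move: y; apply: sb_eq_linear => [||v].
- exact: lin_comp proj_linear (lin_comp (Lmul_linearr _ _) (Lmul_linearr _ _)).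
- exact: lin_comp (Lmul_linearr _ _) (lin_comp proj_linear (Lmul_linearr _ _)).
have [vl|ne] := eqVneq (sb_l v) (sb_r (embB u)); last first.
  by rewrite (Lmul_sb0 _ (u := embB u)) 1?eq_sym // Lmul0r (lin0 proj_linear) Lmul0r.
case: u v vl => i k U [x0 l V] /= ?; subst x0.
pose U' : {group gX (inl i) * gX (inl k)} := U.
have -> : sb (embB (Sb U)) ** sb (Sb V) = sigma ell U' V *: sb (Sb (star U' V)).
  exact: Lmul_s.
have linl := lin_comp proj_linear (Lmul_linearr ell (sb w)).
have linr := lin_comp (Lmul_linearr ell (proj (sb w))) proj_linear.
apply: (lin_scale_eq linl (sigma ell U' V) linr).
case: l V => l V; first exact: (@proj_mul_r i l).
have -> : proj (sb (@Sb _ gX (inl i) (inr l) (star U' V))) = 0 by rewrite proj_sb.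
rewrite Lmul0r.
have [wr|ne] := eqVneq (sb_r w) (inl i); last by rewrite Lmul_sb0 // (lin0 proj_linear).
case: w wr {linl linr} => x0 y0 T /= ?; subst y0.
rewrite Lmul_s (linZ proj_linear) proj_sb /=.
by case: x0 T => ? T; rewrite /= scaler0.
Qed.

Lemma embed_one i : emb (one_ K gT i) = one_ K gX (inl i).
Proof. by rewrite embed_sb. Qed.

Lemma embM a b : emb (a ** b) = emb a ** emb b.
Proof.
move: a; apply: sb_eq_linear => [||u].
- exact: lin_comp embed_linear (Lmul_linearl _ _).
- exact: lin_comp (Lmul_linearl _ _) embed_linear.
rewrite embed_sb; move: b; apply: sb_eq_linear => [||v].
- exact: lin_comp embed_linear (Lmul_linearr _ _).
- exact: lin_comp (Lmul_linearr _ _) embed_linear.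
rewrite embed_sb; have [vl|ne] := eqVneq (sb_r u) (sb_l v); last first.
  by rewrite !Lmul_sb0 // (lin0 embed_linear).
case: u v vl => i j U [j' k V] /= ?; subst j'.
by rewrite !Lmul_s (linZ embed_linear) embed_sb.
Qed.

(** The small algebra is a corner of the large one: between two of its elements
    only the basis elements with both indices in the small family survive. *)
Lemma emb_sandwich a c b : emb a ** c ** emb b = emb (a ** proj c ** b).
Proof.
move: c; apply: sb_eq_linear => [||w].
- exact: lin_comp (Lmul_linearl _ _) (Lmul_linearr _ _).
- exact: lin_comp embed_linear
    (lin_comp (Lmul_linearl _ _) (lin_comp (Lmul_linearr _ _) proj_linear)).
case: w => x y W; rewrite !embM proj_sb.
case: x W => [i|i'] W; last first.
  rewrite [proj_basis _]/= (lin0 embed_linear) Lmul0r Lmul0l.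
  suff -> : emb a ** sb (Sb W) = 0 by rewrite Lmul0l.
  elim/sb_ind: a => [|d' u a IH]; first by rewrite (lin0 embed_linear) Lmul0l.
  by rewrite embed_linear LmulDl LmulZl IH embed_sb Lmul_sb0 // scaler0 addr0.
case: y W => [k|k'] W; first by rewrite embed_sb.
rewrite [proj_basis _]/= (lin0 embed_linear) Lmul0r Lmul0l -LmulA //.
suff -> : sb (Sb W) ** emb b = 0 by rewrite Lmul0r.
elim/sb_ind: b => [|d' u b IH]; first by rewrite (lin0 embed_linear) Lmul0r.
by rewrite embed_linear LmulDr LmulZr IH embed_sb Lmul_sb0 // scaler0 addr0.
Qed.

Lemma LspanP (S' : Lmodule gX ell) (y : S') : Lspan (gT := gT) (gT' := gT') y <->
  exists r : seq (L * S'), y = \sum_(p <- r) lact (emb p.1) p.2.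
Proof. by split=> -[r ->]; exists r; apply: eq_bigr => p _; rewrite embE. Qed.

(** By local units, membership in the span of the small algebra times the module
    is witnessed by a single idempotent. *)
Lemma Lspan_unit (S' : Lmodule gX ell) (y : S') : Lspan (gT := gT) (gT' := gT') y <->
  exists e : L, e ** e = e /\ lact (emb e) y = y.
Proof.
rewrite LspanP; split=> [[r ->]|[e [_ ey]]]; last first.
  by exists [:: (e, y)]; rewrite big_seq1.
have [e [ee er]] := local_unit ell_hom [seq p.1 | p <- r].
exists e; split=> //; rewrite lact_sumr; apply: eq_big_seq => p pr.
by rewrite -lact_mul -embM er // map_f.
Qed.

Lemma iso_LspanP (S : Lmodule gT ell) (S' : Lmodule gX ell) : iso_Lspan S S' <->
  exists f : S -> S', [/\ linear f, injective f,
    forall a x, f (lact a x) = lact (emb a) (f x) &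
    forall y, Lspan (gT := gT) (gT' := gT') y <-> exists x, f x = y].
Proof.
by split=> -[f [linf injf fact imf]]; exists f; split=> // a x; rewrite fact embE.
Qed.

(** ** Extending a simple module *)

(** Green's construction for the corner formed by the small algebra. *)
Lemma simple_extend (S : Lmodule gT ell) : Lsimple S ->
  exists S' : Lmodule gX ell, Lsimple S' /\ iso_Lspan S S'.
Proof.
move=> simS.
pose rho (c : LX) (t : S) : S := lact (proj c) t.
have rl t : linear (rho^~ t).
  by move=> c a b; rewrite /rho proj_linear lactDl lactZl.
have rr a : linear (rho a) by apply: lact_linearr.
have [e c y t [a ->]|t||Q Q0 QD QA|S' [f [simS' linf injf genf fgood]]] :=
    green_module (good := fun e => exists a, e = emb a) ell_hom rl rr.
- by rewrite /rho proj_mul_embed !lact_mul proj_embed.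
- have [e [_ et]] := lact_idem t; exists (emb e); split; first by exists e.
  by rewrite /rho proj_embed.
- by have [x nzx] := simS.1; exists x.
- apply: simS.2; split=> // a x Qx.
  by have := QA (emb a) _ Qx; rewrite /rho proj_embed.
have femb a b t : lact (emb a ** b) (f t) = f (lact a (lact (proj b) t)).
  by rewrite fgood; [rewrite /rho proj_embed | exists a].
have fact a t : lact (emb a) (f t) = f (lact a t).
  have [e [ee et]] := lact_idem t.
  have {1}-> : f t = lact (emb e ** emb e) (f t) by rewrite femb proj_embed !et.
  by rewrite -lact_mul // femb proj_embed_mul proj_embed lact_mul // !et.
exists S'; split=> //; apply/iso_LspanP; exists f; split=> // y; split.
  move=> /Lspan_unit[e [_ <-]]; have [q ->] := genf y; rewrite lact_sumr.
  exists (\sum_(p <- q) lact e (lact (proj p.1) p.2)).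
  by rewrite (lin_sum linf); apply: eq_bigr => p _; rewrite -femb lact_mul.
case=> x <-; apply/Lspan_unit; have [e [ee ex]] := lact_idem x.
by exists e; rewrite fact ex; split=> //; rewrite -[RHS]ee unlock.
Qed.

(** ** Cutting down a simple module *)

(** Any element of the cut-down module is b x for a nonzero x in it and some b
    in the large algebra; by local units, b can be replaced by its projection. *)
Lemma simple_cut (S' : Lmodule gX ell) i : Lsimple S' -> nonzero_at S' (inl i) ->
  exists S : Lmodule gT ell, Lsimple S /\ iso_Lspan S S'.
Proof.
move=> simS' [x0 [/(at_groupP ell_hom) x0i nzx0]].
pose P (y : S') := Lspan (gT := gT) (gT' := gT') y.
have P0 : P 0 by apply/LspanP; exists [::]; rewrite big_nil.
have PD (c : K) x y : P x -> P y -> P (c *: x + y).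
  move=> /LspanP[r ->] /LspanP[r' ->]; apply/LspanP.
  exists ([seq (p.1, c *: p.2) | p <- r] ++ r').
  rewrite big_cat big_map /= scaler_sumr.
  suff -> : \sum_(p <- r) c *: lact (emb p.1) p.2 =
    \sum_(p <- r) lact (emb p.1) (c *: p.2) by [].
  by apply: eq_bigr => p _; rewrite lactZr.
pose act (a : L) (x : S') := lact (emb a) x.
have actP a x : P x -> P (act a x).
  by move=> _; apply/LspanP; exists [:: (a, x)]; rewrite big_seq1.
have act_linl x : P x -> linear (act^~ x).
  by move=> _ c a b; rewrite /act embed_linear lactDl lactZl.
have act_linr a : linear (act a) by apply: lact_linearr.
have act_mul a b x : P x -> act (a ** b) x = act a (act b x).
  by move=> _; rewrite /act embM lact_mul.
have act_unit x : P x -> exists e, e ** e = e /\ act e x = x by move/Lspan_unit.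
have [S [val [vlin vinj vP vact]]] :=
  subspace_module P0 PD actP act_linl act_linr act_mul act_unit.
exists S; split; last by apply/iso_LspanP; exists val.
have Pval z : P (val z) by apply/vP; exists z.
split.
  have [s0 s0E] : exists s0, val s0 = x0.
    apply/vP; apply/LspanP; exists [:: (one_ K gT i, x0)].
    by rewrite big_seq1 embed_one x0i.
  by exists s0 => s00; case: nzx0; rewrite -s0E s00 (lin0 vlin).
move=> Q [Q0 QD QA]; case: (pselect (forall x, Q x -> x = 0)); first by left.
move=> nQ; right => z; have [x Qx nzx] : exists2 y, Q y & y <> 0.
  by apply: contrapT => no; apply: nQ => x Qx; apply: contrapT => nz; apply: no; exists x.
have nzvx : val x <> 0 by rewrite -(lin0 vlin) => /vinj.
have [b zb] := simple_generated simS' nzvx (val z).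
have /Lspan_unit[e [_ ez]] := Pval z; have /Lspan_unit[d [_ dx]] := Pval x.
suff -> : z = lact (e ** proj b ** d) x by apply: QA.
apply: vinj; rewrite vact /act -emb_sandwich !lact_mul dx -zb.
exact: esym.
Qed.

(** ** Existence of minimal groups *)

Lemma nonzero_somewhere (M : Lmodule gT ell) (x : M) : x <> 0 ->
  exists i, nonzero_at M i.
Proof.
move=> nzx; apply: contrapT => no; apply: nzx.
have [e [_ <-]] := lact_idem x; elim/sb_ind: e => [|c u a IH]; first by rewrite lact0l.
rewrite lactDl lactZl IH addr0; suff -> : lact (sb u) x = 0 by rewrite scaler0.
apply: contrapT => nz; apply: no; exists (sb_l u).
by case: u nz => i j U /=; apply: nonzero_at_s.
Qed.

Lemma exists_minimal (M : Lmodule gT ell) i : nonzero_at M i ->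
  exists j, minimal_for M j.
Proof.
move=> nzi; have ex : exists n, `[< exists j, nonzero_at M j /\ #|gT j| = n >].
  by exists #|gT i|; apply/asboolP; exists i.
case: (ex_minnP ex) => n /asboolP[j [nzj <-]] minn; exists j; split=> // k nzk kj.
by apply: factor_group_isog => //; apply: minn; apply/asboolP; exists k.
Qed.

Lemma Lspan_nonzero_at (S : Lmodule gT ell) (S' : Lmodule gX ell) i :
  iso_Lspan S S' -> nonzero_at S i <-> nonzero_at S' (inl i).
Proof.
case/iso_LspanP=> f [linf injf factE imf].
split=> [[x [/(at_groupP ell_hom) xi nzx]]|[y [/(at_groupP ell_hom) yi nzy]]].
  exists (f x); split; last by rewrite -(lin0 linf) => /injf.
  by apply/(at_groupP ell_hom); rewrite -embed_one -factE xi.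
have [x xy] : exists x, f x = y.
  apply/imf/LspanP; exists [:: (one_ K gT i, y)].
  by rewrite big_seq1 embed_one yi.
exists x; split; last by move=> x0; case: nzy; rewrite -xy x0 (lin0 linf).
by apply/(at_groupP ell_hom)/injf; rewrite factE embed_one xy.
Qed.
End Extension.
(** * Representations of automorphism groups *)

Section CharZero.
Variables (K : fieldType) (gT : finGroupType) (G : {group gT}).
Hypothesis charK : [pchar K] =i pred0.

Lemma char0_group : ([pchar K]^'.-group G)%g.
Proof.
rewrite /pgroup /pnat cardG_gt0; apply/allP => p _.
by rewrite inE /= charK.
Qed.

Lemma gring_op_expand n (W : mx_representation K G n) k :
  (k \in group_ring K G)%MS ->
  gring_op W k = \sum_(g in G) gring_proj g k 0 0 *: W g.
Proof.
case/envelop_mxP=> a ->; rewrite linear_sum; apply: eq_bigr => g Gg.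
rewrite linearZ /= gring_opG // linear_sum (bigD1 g) //= linearZ /=.
rewrite gring_projE // eqxx big1 => [|h /andP[Gh /negPf ne]].
  by rewrite addr0 !mxE mulr1.
by rewrite linearZ /= gring_projE // eq_sym ne scaler0.
Qed.

Lemma rsim_gring_op n1 n2 (W1 : mx_representation K G n1)
    (W2 : mx_representation K G n2) k : mx_rsim W1 W2 ->
  (k \in group_ring K G)%MS ->
  (exists w : 'rV_n1, w *m gring_op W1 k <> 0) ->
  (exists w : 'rV_n2, w *m gring_op W2 k <> 0).
Proof.
case=> B e Bfree BW Rk [w nz]; exists (w *m B) => z; apply: nz.
have : w *m gring_op W1 k *m B = 0.
  rewrite -[RHS]z -!mulmxA; congr (_ *m _); rewrite !gring_op_expand //.
  rewrite mulmx_suml mulmx_sumr; apply: eq_bigr => g Gg.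
  by rewrite -scalemxAl BW // scalemxAr.
by move/eqP; rewrite -[X in _ == X](mul0mx _ B) => /eqP/(row_free_inj Bfree).
Qed.

(** An irreducible representation is recognized by the idempotents of the group
    algebra that it does not annihilate, for the central idempotent of its
    Wedderburn component annihilates all the others. *)
Lemma irr_rsim_of_idem n1 n2 (W1 : mx_representation K G n1)
    (W2 : mx_representation K G n2) :
  mx_irreducible W1 -> mx_irreducible W2 ->
  (forall k, (k \in group_ring K G)%MS -> k *m k = k ->
     (exists w : 'rV_n1, w *m gring_op W1 k <> 0) ->
     (exists w : 'rV_n2, w *m gring_op W2 k <> 0)) ->
  mx_rsim W1 W2.
Proof.
move=> irr1 irr2 idem; have cG := char0_group.
suff : `[< mx_rsim W1 W2 >] by move/asboolP.
apply: (@socle_exists _ _ _ _ (regular_repr K G)) => sG; apply/asboolP.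
have eR (i : sG) : (Wedderburn_id i \in group_ring K G)%MS.
  by rewrite -(Wedderburn_sum_pchar sG cG) (sumsmx_sup i) ?Wedderburn_id_mem.
pose i1 := irr_comp sG W1; pose i2 := irr_comp sG W2.
have op1 : gring_op W1 (Wedderburn_id i1) = 1%:M.
  rewrite -(gring_op1 W1) -(Wedderburn_sum_id_pchar sG cG) linear_sum (bigD1 i1) //=.
  rewrite big1 ?addr0 // => i ne; apply: (irr_comp'_op0_pchar cG irr1 ne).
  exact: Wedderburn_id_mem.
have [w nzw] : exists w : 'rV_n2, w *m gring_op W2 (Wedderburn_id i1) <> 0.
  apply: idem; first exact: eR.
    have [_ Re ideR _] := Wedderburn_is_id_pchar cG i1; exact: ideR.
  by have [w nzw] := irr_nonzero irr1; exists w; rewrite op1 mulmx1.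
have [e12|ne] := eqVneq i1 i2; last first.
  case: nzw; rewrite (irr_comp'_op0_pchar cG irr2 ne) ?mulmx0 //.
  exact: Wedderburn_id_mem.
apply: mx_rsim_trans (rsim_irr_comp_pchar sG cG irr1) _.
by rewrite -/i1 e12; apply: mx_rsim_sym; apply: rsim_irr_comp_pchar.
Qed.
End CharZero.

Section AutRep.
Variables (K : fieldType) (I : choiceType) (gT : I -> finGroupType).
Variable ell : nat -> K.
Hypotheses (ell_hom : monoid_hom ell) (charK : [pchar K] =i pred0).
Hypothesis closed : subquotient_closed gT.
Local Notation L := (Lambda K gT).
Local Notation sb := (@sb K I gT).
Local Notation s U := (sb (Sb U)).
Local Notation "a ** b" := (lmul ell a b) (at level 40, left associativity).

Lemma s_graphM j (a b : {perm gT j}) :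
  a \in Aut [set: gT j] -> b \in Aut [set: gT j] ->
  s (graphDelta a) ** s (graphDelta b) = s (graphDelta (b * a)%g).
Proof.
move=> Aa Ab; rewrite s_star // ?star_graphM // => g.
by rewrite !in_graphAut // => _ /eqP ->; apply: Aut1.
Qed.

(** The value of a simple module at a minimal group is a simple module for the
    automorphism group. It is generated by any nonzero element, hence is a
    quotient of the regular representation, and by Maschke's theorem some
    irreducible summand of the latter maps isomorphically onto it. *)
Lemma exists_aut_rep (M : Lmodule gT ell) j : Lsimple M -> minimal_for M j ->
  exists n (W : mx_representation K (Aut_group [set: gT j]) n),
    mx_irreducible W /\ iso_res M W.
Proof.
move=> simM minj; have [x [xj nzx]] := minj.1.
pose G := Aut_group [set: gT j]; pose aG := regular_repr K G.
pose D (theta : {perm gT j}) : M := lact (s (graphDelta theta)) x.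
have Dj theta : at_group j (D theta) by apply: at_group_s.
pose F (v : 'rV[K]_#|G|) : M := \sum_i v 0 i *: D (enum_val i).
have Flin : linear F.
  move=> c u v; rewrite /F scaler_sumr -big_split; apply: eq_bigr => i _.
  by rewrite !mxE scalerDl scalerA.
have Fdelta i : F (delta_mx 0 i) = D (enum_val i).
  rewrite /F (bigD1 i) //= mxE !eqxx scale1r big1 ?addr0 // => k /negPf ne.
  by rewrite mxE eqxx ne scale0r.
have FG theta v : theta \in G ->
    F (v *m aG theta) = lact (s (graphDelta theta)) (F v).
  move=> At; rewrite [v in LHS]row_sum_delta mulmx_suml (lin_sum Flin).
  rewrite [F v]/F lact_sumr; apply: eq_bigr => i _.
  rewrite -scalemxAl (linZ Flin) lactZr -rowE rowK Fdelta.
  have Ai : enum_val i \in G by apply: enum_valP.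
  by rewrite gring_indexK ?groupM // /D -lact_mul s_graphM.
have Fj v : at_group j (F v).
  apply/(at_groupP ell_hom); rewrite lact_sumr; apply: eq_bigr => i _.
  by rewrite lactZr ((at_groupP ell_hom _ _).1 (Dj _)).
have F1 : F (delta_mx 0 (gring_index G 1%g)) = x.
  rewrite Fdelta gring_indexK ?group1 // /D -graphDelta1.
  exact/(at_groupP ell_hom).
suff : `[< exists n (W : mx_representation K (Aut_group [set: gT j]) n),
    mx_irreducible W /\ iso_res M W >] by move/asboolP.
have redG := mx_Maschke_pchar aG (char0_group G charK).
apply: (mx_reducible_semisimple (mxmodule1 aG) redG) => -[J U /= simU defU _].
apply/asboolP.
have [i [w Uw nzFw]] : exists i, exists2 w : 'rV_#|G|, (w <= U i)%MS & F w <> 0.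
  apply: contrapT => no; case: nzx; rewrite -F1.
  have := submx1 (delta_mx 0 (gring_index G 1%g) : 'rV[K]_#|G|).
  rewrite -defU => /sub_sumsmxP[u ->].
  rewrite (lin_sum Flin) big1 // => i _; apply: contrapT => nz.
  by apply: no; exists i, (u i *m U i); rewrite ?submxMl.
have [modU _ _] := simU i; pose W := submod_repr modU.
have irrW : mx_irreducible W by apply/submod_mx_irr.
exists (\rank (U i)), W; split=> //.
pose f (v : 'rV_(\rank (U i))) : M := F (val_submod v).
have flin : linear f by move=> c u v; rewrite /f linearP Flin.
have fW theta : theta \in Aut [set: gT j] -> forall v,
    f (v *m W theta) = lact (s (graphDelta theta)) (f v).
  by move=> At v; rewrite /f val_submodJ // FG.
have finj : injective f.
  have [|||k0|all0] := irr_prop irrW (Q := fun v => f v = 0).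
  - exact: lin0 flin.
  - by move=> c u v fu fv; rewrite flin fu fv scaler0 addr0.
  - by move=> theta v At fv; rewrite fW // fv lact0r.
  - move=> u v fuv; apply/eqP; rewrite -subr_eq0; apply/eqP/k0.
    by rewrite -scaleN1r (linD flin) (linZ flin) fuv scaleN1r addrN.
  by case: nzFw; rewrite -(in_submodK Uw); apply: all0.
exists f; split=> // y; split=> [/(at_groupP ell_hom) yj|[v <-]]; last exact: Fj.
have [a ya] := simple_generated simM nzFw y.
exists (aut_act W a (in_submod _ w)).
rewrite -(res_end ell_hom closed a flin minj) //; last exact: Fj.
by rewrite /f in_submodK // -ya.
Qed.

End AutRep.
(** * Seeds *)

Section Isomorphisms.
Variables (E' E : finGroupType).

(** A pair of inverse maps, rather than a morphism with a domain: such pairs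
    compose and invert without transporting domains. *)
Definition full_iso (theta : E' -> E) (theta' : E -> E') :=
  [/\ {morph theta : x y / (x * y)%g}, cancel theta theta' & cancel theta' theta].

Lemma isom_full_iso (theta : {morphism [set: E'] >-> E})
    (itheta : isom [set: E'] [set: E] theta) :
  full_iso theta (invm (isom_inj itheta)).
Proof.
split=> [x y|x|y]; first by rewrite morphM ?inE.
  by rewrite invmE ?inE.
by rewrite invmK // (isom_im itheta) inE.
Qed.

Lemma full_iso_sym theta theta' : full_iso theta theta' ->
  {morph theta' : x y / (x * y)%g}.
Proof. by case=> tM tK t'K x y; rewrite -{1}(t'K x) -{1}(t'K y) -tM tK. Qed.

Lemma full_iso_isom theta theta' : full_iso theta theta' ->
  exists2 f : {morphism [set: E'] >-> E}, isom [set: E'] [set: E] f & f =1 theta.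
Proof.
case=> tM tK t'K; exists (Morphism (in2W tM : {in [set: E'] &, _})) => //.
apply/isomP; split; first by apply/injmP=> x y _ _; apply: (can_inj tK).
apply/setP=> y; rewrite inE; apply/morphimP; exists (theta' y); rewrite ?inE //=.
Qed.

Lemma isog_full_iso : [set: E'] \isog [set: E] ->
  exists f : {morphism [set: E'] >-> E}, isom [set: E'] [set: E] f.
Proof. by case/isogP=> f injf im_f; exists f; apply/isomP. Qed.

Lemma aut_transfer theta theta' (eps : {perm E}) : full_iso theta theta' ->
  eps \in Aut [set: E] ->
  exists2 eps' : {perm E'}, eps' \in Aut [set: E']
    & forall e, theta (eps' e) = eps (theta e).
Proof.
move=> iso Aeps; have [tM tK t'K] := iso; have t'M := full_iso_sym iso.
have inj : injective (fun e => theta' (eps (theta e))).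
  by apply: inj_comp (can_inj t'K) (inj_comp perm_inj (can_inj tK)).
exists (perm inj); last by move=> e; rewrite permE t'K.
by apply: mem_AutT => x y; rewrite !permE tM AutM // t'M.
Qed.

Lemma conj_autE (theta : {morphism [set: E'] >-> E})
    (itheta : isom [set: E'] [set: E] theta) (eps : {perm E}) e :
  theta (Defs.conj_aut itheta eps e) = eps (theta e).
Proof. by have [_ _ t'K] := isom_full_iso itheta; rewrite permE t'K. Qed.

Lemma iso_graph theta theta' : full_iso theta theta' ->
  exists2 A : {group E * E'}, onto_graph A & forall x y, ((x, y) \in A) = (x == theta y).
Proof.
case=> tM tK t'K; have t1 : theta 1%g = 1%g.
  by apply: (mulgI (theta 1%g)); rewrite -tM !mulg1.
have gA : group_set [set p : E * E' | p.1 == theta p.2].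
  apply/group_setP; split=> [|[x y] [x' y']]; first by rewrite inE /= t1.
  by rewrite !inE /= => /eqP-> /eqP->; rewrite tM.
have inA x y : ((x, y) \in Group gA) = (x == theta y) by rewrite inE.
exists (Group gA) => //; split=> y; last by exists (theta y); rewrite inA.
by rewrite inA -{1}t1 => /eqP/(can_inj tK).
Qed.
End Isomorphisms.

Section SeedEquiv.
Variable K : fieldType.
Implicit Types x y z : aut_pair K.

(** Equivalence of seeds in a form that is visibly symmetric and transitive. *)
Definition seed_link x y := exists theta theta',
  @full_iso (pgrp y) (pgrp x) theta theta' /\
  exists2 B : 'M[K]_(pdim x, pdim y), pdim x = pdim y /\ row_free B
    & forall (eps : {perm pgrp x}) (eps' : {perm pgrp y}),
        eps \in Aut [set: pgrp x] -> eps' \in Aut [set: pgrp y] ->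
        (forall e, theta (eps' e) = eps (theta e)) ->
        prep x eps *m B = B *m prep y eps'.

Lemma seed_equivP x y : seed_equiv x y <-> seed_link x y.
Proof.
split=> [[theta [itheta [B exy Bfree BW]]]|[theta [theta' [iso [B [exy Bfree] BW]]]]].
  exists theta, (invm (isom_inj itheta)); split; first exact: isom_full_iso.
  exists B => // eps eps' Aeps Aeps' e_eps; rewrite BW //=.
  suff -> : eps' = Defs.conj_aut itheta eps by [].
  have [_ tK _] := isom_full_iso itheta.
  by apply/permP=> e; apply: (can_inj tK); rewrite e_eps conj_autE.
have [f isof fE] := full_iso_isom iso; exists f, isof; exists B => // eps Aeps.
apply: BW => //; first exact: conj_aut_Aut.
by move=> e; rewrite -!fE conj_autE.
Qed.

Lemma seed_equiv_refl x : seed_equiv x x.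
Proof.
apply/seed_equivP; exists id, id; split=> //.
exists 1%:M; first by rewrite row_free_unit unitmx1.
move=> eps eps' _ _ e; rewrite mulmx1 mul1mx; suff -> : eps' = eps by [].
by apply/permP=> ?; apply: e.
Qed.

Lemma seed_equiv_sym x y : seed_equiv x y -> seed_equiv y x.
Proof.
case/seed_equivP=> theta [theta' [iso [B [exy Bfree] BW]]]; apply/seed_equivP.
have [tM tK t'K] := iso.
exists theta', theta; split; first by split=> //; apply: full_iso_sym iso.
case: x y exy theta theta' iso B Bfree BW tM tK t'K => E n W [E' n' W'] /= exy.
subst n'; rewrite /= => theta theta' iso B Bfree BW tM tK t'K.
rewrite row_free_unit in Bfree.
exists (invmx B); first by rewrite row_free_unit unitmx_inv.
move=> eps' eps Aeps' Aeps e_eps; apply: (can_inj (mulmxK Bfree)).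
rewrite mulmxKV // -mulmxA (BW eps eps') ?mulKmx //.
by move=> e; apply: (can_inj t'K); rewrite e_eps !tK.
Qed.

Lemma seed_equiv_trans x y z : seed_equiv x y -> seed_equiv y z -> seed_equiv x z.
Proof.
case/seed_equivP=> theta [theta' [iso [B [exy Bfree] BW]]].
case/seed_equivP=> phi [phi' [isop [C [eyz Cfree] CW]]]; apply/seed_equivP.
have [tM tK t'K] := iso; have [pM pK p'K] := isop.
exists (theta \o phi), (phi' \o theta'); split.
  split=> [a b|a|a] /=; first by rewrite pM tM.
    by rewrite tK pK.
  by rewrite p'K t'K.
exists (B *m C).
  split; first exact: etrans exy eyz.
  by rewrite /row_free mxrankMfree //; rewrite /row_free in Bfree.
move=> eps eps'' Aeps Aeps'' e_eps.
have [eps' Aeps' e'] := aut_transfer iso Aeps.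
rewrite mulmxA (BW _ _ Aeps Aeps') // -!mulmxA (CW _ _ Aeps' Aeps'') //.
by move=> e; apply: (can_inj tK); rewrite e' -e_eps.
Qed.

Lemma transport_irr (E' E : finGroupType) (theta : {morphism [set: E'] >-> E})
    (itheta : isom [set: E'] [set: E] theta) n
    (W : mx_representation K (Aut_group [set: E']) n) :
  mx_irreducible W -> mx_irreducible (transport itheta W).
Proof.
move=> [_ nz1 simW]; split=> //; first exact: mxmodule1.
move=> U modU sU nzU; apply: simW => //; apply/mxmoduleP=> eps' Aeps'.
have iso := isom_full_iso itheta; have [tM tK t'K] := iso.
have [|eps Aeps e_eps] := @aut_transfer _ _ (invm (isom_inj itheta)) theta eps' _ Aeps'.
  by split=> //; apply: full_iso_sym iso.
suff -> : eps' = Defs.conj_aut itheta eps by apply: (mxmoduleP modU).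
apply/permP=> e; apply: (can_inj tK); rewrite conj_autE.
by have := e_eps (theta e); rewrite tK => <-; rewrite t'K.
Qed.

Lemma seed_equiv_irr x y : seed_equiv x y ->
  mx_irreducible (prep y) -> mx_irreducible (prep x).
Proof.
case=> theta [itheta rsim] irr; apply: mx_rsim_irr (mx_rsim_sym rsim) _.
exact: transport_irr.
Qed.
End SeedEquiv.

Section TransportRes.
Variables (K : fieldType) (I : choiceType) (gT : I -> finGroupType).
Variable ell : nat -> K.
Hypothesis ell_hom : monoid_hom ell.
Local Notation sb := (@sb K I gT).
Local Notation s U := (sb (Sb U)).
Local Notation "a ** b" := (lmul ell a b) (at level 40, left associativity).

Lemma onto_graph_graphDelta (E : finGroupType) (theta : {perm E}) :
  theta \in Aut [set: E] -> onto_graph (graphDelta theta).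
Proof.
move=> At; split=> x; last by exists (theta x); rewrite in_graphAut.
by rewrite in_graphAut // -[X in X == _](Aut1 At) => /eqP/perm_inj.
Qed.

(** The graph of the isomorphism carries the value of M at one group to its value
    at the other. *)
Lemma iso_res_transport (M : Lmodule gT ell) i j m n
    (V : mx_representation K (Aut_group [set: gT i]) m)
    (W : mx_representation K (Aut_group [set: gT j]) n) :
  seed_equiv (AutPair V) (AutPair W) -> iso_res M W -> iso_res M V.
Proof.
case/seed_equivP=> /= theta [theta' [iso [B [/= emn Bfree] BW]]].
move=> [f [linf injf imf fW]]; have [tM tK t'K] := iso.
have [A oA inA] := iso_graph iso.
have fj w : at_group j (f w) by apply/imf; exists w.
subst m; rewrite row_free_unit in Bfree.
exists (fun v => lact (s A) (f (v *m B))); split.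
- by move=> c u v; rewrite mulmxDl -scalemxAl linf lactDr lactZr.
- move=> u v e; apply: (can_inj (mulmxK Bfree)); apply: injf.
  apply/eqP; rewrite -subr_eq0; apply/eqP; apply: (s_lact_inj ell_hom oA).
    by apply/imf; exists (u *m B - v *m B); rewrite (linD linf) -scaleN1r (linZ linf) scaleN1r.
  by rewrite lactDr -scaleN1r lactZr e scaleN1r addrN.
- move=> y; split=> [/(at_groupP ell_hom) yi|[v <-]]; last exact: at_group_s.
  have /imf[w fw] : at_group j (lact (s (op_rel A)) y) by apply: at_group_s.
  exists (w *m invmx B); rewrite mulmxKV // fw -lact_mul s_star_op //.
  suff -> : star A (op_rel A) = graphDelta id by [].
  apply: group_relP => a b; rewrite in_graph1; split.
    by case/starP=> c []; rewrite in_op_rel !inA => /eqP-> /eqP->.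
  move/eqP=> <-; apply/starP; exists (theta' a).
  by rewrite in_op_rel inA t'K.
move=> eps Aeps v; have [eps' Aeps' e_eps] := aut_transfer iso Aeps.
rewrite -mulmxA (BW _ _ Aeps Aeps' e_eps) mulmxA fW //.
rewrite -!lact_mul !s_star_onto //; last exact: onto_graph_graphDelta.
suff -> : star A (graphDelta eps') = star (graphDelta eps) A by [].
apply: group_relP => a b; split=> /starP[c []].
  rewrite inA in_graphAut // => /eqP-> /eqP->.
  by apply/starP; exists (theta b); rewrite inA in_graphAut // e_eps.
rewrite inA in_graphAut // => /eqP-> /eqP->.
by apply/starP; exists (eps' b); rewrite inA in_graphAut // e_eps.
Qed.
End TransportRes.
(** * The seed of a simple module *)

Section Seeds.
Variables (K : fieldType) (I I' : choiceType).
Variables (gT : I -> finGroupType) (gT' : I' -> finGroupType).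
Variable ell : nat -> K.
Hypotheses (ell_hom : monoid_hom ell) (charK : [pchar K] =i pred0).
Local Notation gX := (ext_family gT gT').
Hypothesis closed : subquotient_closed gX.
Local Notation sb := (@sb K _ _).
Local Notation s U := (sb (Sb U)).
Local Notation "a ** b" := (lmul ell a b) (at level 40, left associativity).
Local Notation emb := (@emb K I I' gT gT').

(** Any isomorphism of E with a group of the large family lets mu_phi factor
    through that group, where it becomes the action of Aut(E) by graphs. *)
Lemma mu_factor (E : finGroupType) i (B Y : {group gT i})
    (phi : {morphism (B / Y)%g >-> E}) (iphi : isom (B / Y)%g [set: E] phi)
    j (theta : {morphism [set: gX j] >-> E})
    (itheta : isom [set: gX j] [set: E] theta) : (Y <| B)%g ->
  exists2 A : {group gX (inl i) * gX j}, onto_graph A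
    & forall eps, eps \in Aut [set: E] ->
      emb (mu_aut ell iphi eps) = (ell #|Y|)^-1 *:
        (s A ** s (graphDelta (Defs.conj_aut itheta eps)) ** s (op_rel A)).
Proof.
move=> nYB; pose f e := invm (isom_inj iphi) (theta e).
have in_im y : y \in (phi @* (B / Y))%g by rewrite (isom_im iphi) inE.
have [tM tK t'K] := isom_full_iso itheta.
have fM : {morph f : x y / (x * y)%g} by move=> x y; rewrite /f tM morphM.
have phif e : phi (f e) = theta e by rewrite invmK.
have finj : injective f.
  by move=> x y e; apply: (can_inj tK); rewrite -!phif e.
have fphi c : c \in (B / Y)%g -> f (invm (isom_inj itheta) (phi c)) = c.
  by move=> Bc; rewrite /f t'K invmE.
have fim c : c \in (B / Y)%g <-> exists e, f e = c.
  split=> [Bc|[e <-]]; first by exists (invm (isom_inj itheta) (phi c)); apply: fphi.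
  by have /morphimP[c' _ Bc' ec'] := in_im (theta e); rewrite /f ec' invmE.
have [A0 oA inA] := section_graph nYB fM finj fim.
pose A : {group gX (inl i) * gX j} := A0; rewrite -/A in oA inA.
exists A => // eps Aeps; have Aeps' := conj_aut_Aut itheta Aeps.
rewrite /mu_aut (linZ (@embed_linear _ _ _ gT gT')) s_E embed_sb.
rewrite (s_star_onto ell_hom _ oA) (s_star_op ell_hom _ oA).
set U := sectionDelta _ _; pose U' : {group gX (inl i) * gX (inl i)} := U.
suff -> : star (star A (graphDelta (Defs.conj_aut itheta eps))) (op_rel A) = U' by [].
have inU b b' : ((b, b') \in U') = [&& b \in B, b' \in B &
    coset Y b == invm (isom_inj iphi) (eps (phi (coset Y b')))].
  by rewrite [_ \in _](congr1 (fun D : {set _} => (b, b') \in D)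
    (mu_aut_group iphi nYB Aeps)) inE.
apply: group_relP => b b'; rewrite inU; split.
  case/starP=> e2 [/starP[e1 [Ab +]] +]; rewrite in_op_rel in_graphAut // => /eqP e12.
  move: Ab; rewrite !inA => /andP[-> /eqP eb] /andP[-> /eqP eb'] /=.
  by rewrite eb eb' phif /f e12 conj_autE.
case/and3P=> Bb Bb' /eqP eb.
have /fim[e2 e2b] : coset Y b' \in (B / Y)%g by apply: mem_quotient.
apply/starP; exists e2; split; last by rewrite in_op_rel inA Bb' e2b eqxx.
apply/starP; exists (Defs.conj_aut itheta eps e2).
by rewrite in_graphAut // inA Bb eqxx eb -e2b phif /f conj_autE eqxx.
Qed.

(** By mu_factor, mu_phi(k) acts as s_A k s_{A^o} up to a nonzero scalar, where s_A
    is injective on S'(E) and s_{A^o} maps S'(G) onto S'(E). *)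
Lemma mu_nonzero (S : Lmodule gT ell) (S' : Lmodule gX ell) j n
    (W : mx_representation K (Aut_group [set: gX j]) n)
    (E : finGroupType) i (B Y : {group gT i})
    (phi : {morphism (B / Y)%g >-> E}) (iphi : isom (B / Y)%g [set: E] phi)
    (theta : {morphism [set: gX j] >-> E})
    (itheta : isom [set: gX j] [set: E] theta) (k : 'M[K]_#|Aut [set: E]|) :
  iso_Lspan S S' -> iso_res S' W -> (Y <| B)%g ->
  (k \in group_ring K (Aut_group [set: E]))%MS ->
  (exists m : S, at_group i m /\ lact (mu ell iphi k) m <> 0) <->
  (exists w : 'rV[K]_n, w *m gring_op (transport itheta W) k <> 0).
Proof.
move=> /iso_LspanP[h [linh injh hE imh]] [g [ling injg img gW]] nYB Rk.
have [A oA emu] := mu_factor iphi itheta nYB.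
have gj w : at_group j (g w) by apply/img; exists w.
have nzY : (ell #|Y|)^-1 != 0 by rewrite invr_eq0 ell_neq0.
have mu_act y w : lact (s (op_rel A)) y = g w ->
    lact (emb (mu ell iphi k)) y =
    (ell #|Y|)^-1 *: lact (s A) (g (w *m gring_op (transport itheta W) k)).
  move=> yw; rewrite /mu (lin_sum (@embed_linear _ _ _ gT gT')) lact_suml.
  rewrite gring_op_expand // mulmx_sumr (lin_sum ling) lact_sumr scaler_sumr.
  apply: eq_bigr => eps Aeps; rewrite (linZ (@embed_linear _ _ _ gT gT')) emu //.
  rewrite !lactZl !lact_mul yw -gW ?conj_aut_Aut //.
  by rewrite -scalemxAr (linZ ling) lactZr !scalerA mulrC.
split=> [[m [_ nzm]]|[w nzw]].
  have /img[w gw] : at_group j (lact (s (op_rel A)) (h m)) by apply: at_group_s.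
  exists w => z; case: nzm; apply: injh; rewrite hE (mu_act _ _ (esym gw)) z.
  by rewrite (lin0 ling) lact0r scaler0 (lin0 linh).
pose y := lact (s A) (g w).
have yi : lact (one_ K gX (inl i)) y = y by apply/(at_groupP ell_hom)/at_group_s.
have [m hm] : exists m, h m = y.
  by apply/imh/LspanP; exists [:: (one_ K gT i, y)]; rewrite big_seq1 embed_one yi.
exists m; split.
  by apply/(at_groupP ell_hom)/injh; rewrite hE embed_one hm yi.
move=> z; case: nzw; apply: injg; rewrite (lin0 ling).
have oAw : lact (s (op_rel A)) (h m) = g (ell #|lbullet A| *: w).
  by rewrite hm s_op_lact // (linZ ling).
have := mu_act _ _ oAw; rewrite -hE z (lin0 linh) -scalemxAl (linZ ling) lactZr.
move/esym/eqP; rewrite !scaler_eq0 (negPf nzY) (negPf (ell_neq0 ell_hom (lbullet_gt0 A))) /=.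
by move/eqP/(s_lact_inj ell_hom oA); apply.
Qed.

Lemma mu_nonzero_at (S : Lmodule gT ell) (S' : Lmodule gX ell)
    (E : finGroupType) i (B Y : {group gT i})
    (phi : {morphism (B / Y)%g >-> E}) (iphi : isom (B / Y)%g [set: E] phi)
    (k : 'M[K]_#|Aut [set: E]|) j (m : S) :
  iso_Lspan S S' -> (Y <| B)%g -> [set: gX j] \isog [set: E] ->
  lact (mu ell iphi k) m <> 0 -> nonzero_at S' j.
Proof.
move=> /iso_LspanP[h [linh injh hE imh]] nYB /isog_full_iso[theta itheta] nzm.
have [A oA emu] := mu_factor iphi itheta nYB.
apply: (@nonzero_at_s _ _ _ _ ell_hom S' _ _ (op_rel A) (h m)) => z; case: nzm.
apply: injh; rewrite hE (lin0 linh) /mu (lin_sum (@embed_linear _ _ _ gT gT')).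
rewrite lact_suml big1 // => eps Aeps; rewrite (linZ (@embed_linear _ _ _ gT gT')) emu //.
by rewrite !lactZl !lact_mul z !lact0r !scaler0.
Qed.

Definition seed_data (S : Lmodule gT ell) j n
    (W : mx_representation K (Aut_group [set: gX j]) n) :=
  exists S' : Lmodule gX ell,
    [/\ Lsimple S', minimal_for S' j, iso_res S' W & iso_Lspan S S'].

Lemma iso_ResP (S' : Lmodule gX ell) j n
    (W : mx_representation K (Aut_group [set: gX j]) n) :
  iso_Res S' W <-> iso_res S' W.
Proof.
by split=> -[f [linf injf imf fW]]; exists f; split=> // theta At w;
   rewrite fW // s_E.
Qed.

Lemma associatedP (S : Lmodule gT ell) (x : aut_pair K) : associated gT' S x <->
  exists j n (W : mx_representation K (Aut_group [set: gX j]) n),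
    seed_equiv x (AutPair W) /\ seed_data S W.
Proof.
by split=> -[j [n [W [xW [S' [simS' minS' resS' spanS']]]]]]; exists j, n, W;
   split=> //; exists S'; split=> //; apply/iso_ResP.
Qed.

Lemma seed_equiv_isog (x y : aut_pair K) : seed_equiv x y ->
  [set: pgrp x] \isog [set: pgrp y].
Proof. by case=> theta [itheta _]; rewrite isog_sym; apply: isom_isog itheta. Qed.

Lemma seed_group_factor (x : aut_pair K) (G : finGroupType) : 
  factor_group (pgrp x) G -> exists (B Y : {group G}), (Y <| B)%g /\
    exists phi : {morphism (B / Y)%g >-> pgrp x}, isom (B / Y)%g [set: pgrp x] phi.
Proof.
case=> B [Y [nYB]]; rewrite isog_sym => /isogP[phi injphi im_phi].
by exists B, Y; split=> //; exists phi; apply/isomP.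
Qed.

(** The seed of a simple module satisfies the three conditions. For (c), apply
    (b) for the other seed to the idempotent 1: as it does not annihilate the
    module, neither does some map through E', so the module lives at E'. *)
Lemma associated_conditions (S : Lmodule gT ell) (x : aut_pair K) :
  associated gT' S x -> [/\ cond_a S x, cond_b S x & cond_c S x].
Proof.
case/associatedP=> j [n [W [xW [S' [simS' minS' resS' spanS']]]]].
have iso_x := seed_equiv_isog xW.
have live i : nonzero_at S' i <-> factor_group (pgrp x) (gX i).
  rewrite (simple_support ell_hom closed _ simS' minS').
  split=> [|xi]; last apply: factor_group_trans xi.
    by apply: factor_group_trans; apply: isog_factor_group.
  by apply: isog_factor_group; rewrite isog_sym.
split.
- by move=> i; rewrite (Lspan_nonzero_at ell_hom _ spanS') live.
- move=> i B Y nYB phi iphi k Rk kk; have [theta [itheta rsim]] := xW.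
  rewrite (mu_nonzero iphi itheta spanS' resS' nYB Rk).
  by split; apply: rsim_gring_op Rk => //; apply: mx_rsim_sym.
move=> x' [[i fi] irr'] a' b'.
have [B [Y [nYB [phi iphi]]]] := seed_group_factor fi.
have [q iso_q] : exists q, [set: gX q] \isog [set: pgrp x'].
  have [q iso] := @closed (inl i) B Y nYB; exists q.
  by apply: isog_trans iso _; apply: isom_isog iphi.
have [w nzw] := irr_nonzero irr'.
have [] := b' i B Y nYB phi iphi 1%:M (envelop_mx1 _) (mulmx1 _).
rewrite gring_op1 => _ [|m [_ nzm]]; first by exists w; rewrite mulmx1.
apply: factor_group_trans (isog_factor_group iso_q); apply/live.
exact: mu_nonzero_at spanS' nYB iso_q nzm.
Qed.

(** Conversely the conditions determine the seed: (c) identifies the group, and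
    (b) then identifies the representation by the idempotents it supports. *)
Lemma conditions_unique (S : Lmodule gT ell) (x : aut_pair K) j n
    (W : mx_representation K (Aut_group [set: gX j]) n) :
  is_seed gT x -> is_seed gT (AutPair W) -> seed_data S W ->
  [/\ cond_a S x, cond_b S x & cond_c S x] -> seed_equiv x (AutPair W).
Proof.
move=> seedx seedW dataW [ax bx cx].
have [aW bW cW] : [/\ cond_a S (AutPair W), cond_b S (AutPair W) & cond_c S (AutPair W)].
  apply: associated_conditions; apply/associatedP; exists j, n, W; split=> //.
  exact: seed_equiv_refl.
have iso := factor_group_anti (cW x seedx ax bx) (cx _ seedW aW bW).
have [theta itheta] := isog_full_iso iso.
have [S' [simS' minS' resS' spanS']] := dataW.
have [[i fi] irrx] := seedx; have [_ irrW] := seedW.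
have [B [Y [nYB [phi iphi]]]] := seed_group_factor fi.
exists theta, itheta; apply: (irr_rsim_of_idem charK irrx); first exact: transport_irr.
move=> k Rk kk nz; apply/(mu_nonzero iphi itheta spanS' resS' nYB Rk).
exact/(bx i B Y nYB phi iphi k Rk kk).
Qed.

(** Extend S to the large family and read off a minimal group and the
    representation there. *)
Lemma exists_seed (S : Lmodule gT ell) : Lsimple S ->
  exists j n (W : mx_representation K (Aut_group [set: gX j]) n),
    is_seed gT (AutPair W) /\ seed_data S W.
Proof.
move=> simS; have [S' [simS' spanS']] := simple_extend gT' ell_hom simS.
have [x nzx] := simS.1; have [i nzi] := nonzero_somewhere ell_hom nzx.
have nzi' : nonzero_at S' (inl i) by apply/(Lspan_nonzero_at ell_hom _ spanS').
have [j minj] := exists_minimal nzi'.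
have [n [W [irrW resW]]] := exists_aut_rep ell_hom charK closed simS' minj.
exists j, n, W; split; last by exists S'.
split=> //; exists i.
exact: (simple_support ell_hom closed (inl i) simS' minj).1 nzi'.
Qed.

Lemma iso_Lspan_trans (S : Lmodule gT ell) (S1 S2 : Lmodule gX ell) :
  Liso S1 S2 -> iso_Lspan S S1 -> iso_Lspan S S2.
Proof.
move=> [h [linh bijh hE]] /iso_LspanP[f [linf injf fE imf]].
have [h' hK h'K] := bijh; apply/iso_LspanP; exists (h \o f); split.
- exact: lin_comp linh linf.
- exact: inj_comp (can_inj hK) injf.
- by move=> a x; rewrite /= fE hE.
move=> y; split=> [/(Lspan_unit ell_hom)[e [ee ey]]|[x <-]].
  have [x fx] : exists x, f x = h' y.
    apply/imf/(Lspan_unit ell_hom); exists e; split=> //.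
    by apply: (can_inj hK); rewrite hE h'K.
  by exists x; rewrite /= fx h'K.
have /(Lspan_unit ell_hom)[e [ee ex]] : Lspan (gT := gT) (gT' := gT') (f x).
  by apply/imf; exists x.
by apply/(Lspan_unit ell_hom); exists e; split=> //=; rewrite -hE ex.
Qed.

Lemma iso_Lspan_Liso (S1 S2 : Lmodule gT ell) (S' : Lmodule gX ell) :
  iso_Lspan S1 S' -> iso_Lspan S2 S' -> Liso S1 S2.
Proof.
move=> /iso_LspanP[f [linf injf fE imf]] /iso_LspanP[g [ling injg gE img]].
have to2 x : exists y, g y = f x by apply/img/imf; exists x.
have to1 y : exists x, f x = g y by apply/imf/img; exists y.
pose h x := sval (cid (to2 x)); pose h' y := sval (cid (to1 y)).
have hP x : g (h x) = f x by rewrite /h; case: cid.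
have h'P y : f (h' y) = g y by rewrite /h'; case: cid.
exists h; split.
- by move=> c x y; apply: injg; rewrite hP linf ling !hP.
- by exists h' => [x|y]; [apply: injf; rewrite h'P hP | apply: injg; rewrite hP h'P].
- by move=> a x; apply: injg; rewrite hP fE gE hP.
Qed.

Lemma associated_Liso (S1 S2 : Lmodule gT ell) x :
  Liso S1 S2 -> associated gT' S2 x -> associated gT' S1 x.
Proof.
move=> [h [linh bijh hE]] /associatedP[j [n [W [xW [S' [simS' minS' resS' spanS']]]]]].
apply/associatedP; exists j, n, W; split=> //; exists S'; split=> //.
have /iso_LspanP[f [linf injf fE imf]] := spanS'; have [h' hK h'K] := bijh.
apply/iso_LspanP; exists (f \o h); split.
- exact: lin_comp linf linh.
- exact: inj_comp injf (can_inj hK).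
- by move=> a x0; rewrite /= hE fE.
move=> y; rewrite imf; split=> [[z <-]|[z <-]]; last by exists (h z).
by exists (h' z); rewrite /= h'K.
Qed.

Lemma associated_equiv (S : Lmodule gT ell) x y :
  seed_equiv x y -> associated gT' S y -> associated gT' S x.
Proof.
move=> xy /associatedP[j [n [W [yW data]]]]; apply/associatedP.
by exists j, n, W; split=> //; apply: seed_equiv_trans xy yW.
Qed.

Lemma is_seed_equiv (x y : aut_pair K) : seed_equiv x y -> is_seed gT y -> is_seed gT x.
Proof.
move=> xy [[i fi] irr]; split; last exact: seed_equiv_irr xy irr.
exists i; apply: factor_group_trans fi.
exact/isog_factor_group/seed_equiv_isog.
Qed.

(** Simple modules with the same seed are isomorphic: their extensions to the
    large family agree at a common minimal group. *)
Lemma same_seed_Liso (S1 S2 : Lmodule gT ell) x :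
  associated gT' S1 x -> associated gT' S2 x -> Liso S1 S2.
Proof.
case/associatedP=> j1 [n1 [W1 [xW1 [S1' [sim1 min1 res1 span1]]]]].
case/associatedP=> j2 [n2 [W2 [xW2 [S2' [sim2 min2 res2 span2]]]]].
have W12 : seed_equiv (AutPair W1) (AutPair W2).
  exact: seed_equiv_trans (seed_equiv_sym xW1) xW2.
have min2' : minimal_for S2' j1.
  apply: minimal_isog min2 => //; exact: (seed_equiv_isog W12).
have res2' : iso_res S2' W1 := iso_res_transport ell_hom W12 res2.
have iso12 := iso_res_unique ell_hom closed sim1 sim2 min1 min2' res1 res2'.
exact: iso_Lspan_Liso (iso_Lspan_trans iso12 span1) span2.
Qed.

Lemma exists_simple (x : aut_pair K) : is_seed gT x ->
  exists S : Lmodule gT ell, Lsimple S /\ associated gT' S x.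
Proof.
move=> [[i fi] irr]; have [B [Y [nYB [phi iphi]]]] := seed_group_factor fi.
have [j iso_j] : exists j, [set: gX j] \isog [set: pgrp x].
  have [j iso] := @closed (inl i) B Y nYB; exists j.
  by apply: isog_trans iso _; apply: isom_isog iphi.
have [theta itheta] : exists theta : {morphism [set: pgrp x] >-> gX j},
    isom [set: pgrp x] [set: gX j] theta.
  by apply: isog_full_iso; rewrite isog_sym.
pose W := transport itheta (prep x).
have irrW : mx_irreducible W by apply: transport_irr.
have xW : seed_equiv x (AutPair W).
  by apply: seed_equiv_sym; exists theta, itheta; apply: mx_rsim_refl.
have [S' [simS' minS' resS']] := simple_of_aut_rep ell_hom irrW.
have nzi : nonzero_at S' (inl i).
  apply/(simple_support ell_hom closed (inl i) simS' minS').
  exact: factor_group_trans (isog_factor_group iso_j) fi.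
have [S [simS spanS]] := simple_cut ell_hom simS' nzi.
by exists S; split=> //; apply/associatedP; exists j, _, W; split=> //; exists S'.
Qed.

End Seeds.

Theorem theorem3p6 (K : fieldType) (charK : [pchar K]%R =i pred0)
    (I : choiceType) (I_nonempty : inhabited I) (gT : I -> finGroupType)
    (ell : nat -> K) (ell_hom : monoid_hom ell)
    (I' : choiceType) (gT' : I' -> finGroupType)
    (closed : subquotient_closed (ext_family gT gT')) :
  [/\ forall S : Lmodule gT ell, Lsimple S ->
        exists x : aut_pair K, is_seed gT x /\ associated gT' S x,
      forall x : aut_pair K, is_seed gT x ->
        exists S : Lmodule gT ell, Lsimple S /\ associated gT' S x
    & forall (S1 S2 : Lmodule gT ell) (x1 x2 : aut_pair K),
        Lsimple S1 -> Lsimple S2 -> is_seed gT x1 -> is_seed gT x2 ->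
        associated gT' S1 x1 -> associated gT' S2 x2 ->
        Liso S1 S2 <-> seed_equiv x1 x2] /\
  (forall S : Lmodule gT ell, Lsimple S ->
   forall x : aut_pair K, is_seed gT x ->
     associated gT' S x <-> [/\ cond_a S x, cond_b S x & cond_c S x]).
Proof.
split; [split|].
- move=> S simS; have [j [n [W [seedW dataW]]]] := exists_seed ell_hom charK closed simS.
  exists (AutPair W); split=> //; apply/associatedP; exists j, n, W.
  by split=> //; apply: seed_equiv_refl.
- by move=> x; apply: exists_simple.
- move=> S1 S2 x1 x2 sim1 sim2 seed1 seed2 ass1 ass2; split=> [iso12|x12].
    have ass12 := associated_Liso iso12 ass2.
    have /associatedP[j [n [W [x2W dataW]]]] := ass12.
    apply: seed_equiv_trans (seed_equiv_sym x2W).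
    apply: (conditions_unique ell_hom charK closed seed1 _ dataW).
      exact: is_seed_equiv (seed_equiv_sym x2W) seed2.
    exact: (associated_conditions ell_hom closed ass1).
  exact: same_seed_Liso ass1 (associated_equiv x12 ass2).
move=> S simS x seedx; split; first exact: (associated_conditions ell_hom closed).
move=> conds; have [j [n [W [seedW dataW]]]] := exists_seed ell_hom charK closed simS.
apply/associatedP; exists j, n, W; split=> //.
exact: (conditions_unique ell_hom charK closed seedx seedW dataW conds).
Qed.
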